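(* Let $n\ge 2$ and let $\Phi$ be an integrator for Hamiltonian systems in $\mathbb{R}^{2n}$. Let $H(q,p)=\sum_{i=1}^n p_i^2/2$ on $\mathbb{R}^{2n}$, and let $U\subset\mathbb{R}^{2n}$ be an open neighbourhood of the set $\{((q_1,\dots,q_1),(1,\dots,1))\mid q_1\in\mathbb{R}\}$. Suppose: (1) $\Phi$ is consistent for $H$ (at every point of $\mathbb{R}^{2n}$); (2) $\Phi$ is computationally reasonable; (3) $\Phi$ conserves energy for any Hamiltonian, any point $(q,p)$ and any $\Delta t$ for which it is defined; (4) whenever a Hamiltonian on $\mathbb{R}^{2n}$ has the form $G(q,p)=\sum_{i=1}^n h(q_i,p_i)$ with $h:\mathbb{R}^2\to\mathbb{R}$, there is an integrator $\phi$ on $\mathbb{R}^2$ such that $\pi_i\Phi(G,(q,p),\Delta t)=\phi(h,(q_i,p_i),\Delta t)$ for $i=1,\dots,n$, for any $(q,p)$ and $\Delta t$ for which the integrator is defined; (5) for sufficiently small $\Delta t$, $\Phi(H,(q,p),\Delta t)$ is defined, continuous in $(q,p)$, and conserves volume for $(q,p)\in U$. Then for all sufficiently small $\Delta t>0$ there is a $C_0^\infty$ function $V:\mathbb{R}\to\mathbb{R}$ such that, if $\widetilde H(q,p)=\sum_{i=1}^n\left(p_i^2/2+V(q_i)\right)$, then $\Phi(\widetilde H,\cdot,\Delta t)$ is not simultaneously defined, continuous, and volume-conserving on $U$. Moreover, for each such $\Delta t$, $V$ can be chosen so that the same conclusion holds with $V$ replaced by $\lambda V$ for every $\lambda\in(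0,1)$.
   Context: Phase space is $\mathbb{R}^{2n}$ with coordinates $(q,p)$, $q=(q_1,\dots,q_n)$, $p=(p_1,\dots,p_n)\in\mathbb{R}^n$; $\pi_i(q,p)=(q_i,p_i)$ for $i=1,\dots,n$. The Hamiltonian system of $H:\mathbb{R}^{2n}\to\mathbb{R}$ is $dq/dt=\partial H/\partial p$, $dp/dt=-\partial H/\partial q$; its time-$t$ flow map is denoted $S^t$. Integrator (on $\mathbb{R}^{2n}$, any $n\ge1$): a function $\Phi$ that takes as arguments a Hamiltonian $H:\mathbb{R}^{2n}\to\mathbb{R}$, a point $(q,p)\in\mathbb{R}^{2n}$ and a step $\Delta t\in[0,\infty)$, and either returns a point $\Phi(H,(q,p),\Delta t)\in\mathbb{R}^{2n}$ or is not defined (so it is a partial function). For a multi-index $\alpha\in\mathbb{N}_0^{2n}$, $\partial_\alpha H=\frac{\partial^{\alpha_1}}{\partial q_1^{\alpha_1}}\cdots\frac{\partial^{\alpha_n}}{\partial q_n^{\alpha_n}}\frac{\partial^{\alpha_{n+1}}}{\partial p_1^{\alpha_{n+1}}}\cdots\frac{\partial^{\alpha_{2n}}}{\partial p_n^{\alpha_{2n}}}H$. Computationally reasonable: $\Phi$ is computationally reasonable if for each $H:\mathbb{R}^{2n}\to\mathbb{R}$, $(q,p)\in\mathbb{R}^{2n}$ and $\Delta t\ge 0$ there exist $m\in\mathbb{N}_0$, points $(r^j,s^j)\in\mathbb{R}^{2n}$ and multi-indices $\alpha^j\in\mathbb{N}_0^{2n}$, $j=1,\dots,m$, such that for any $\widetilde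 H:\mathbb{R}^{2n}\to\mathbb{R}$ with $\partial_{\alpha^j}\widetilde H(r^j,s^j)=\partial_{\alpha^j}H(r^j,s^j)$ for $j=1,\dots,m$, either $\Phi(H,(q,p),\Delta t)=\Phi(\widetilde H,(q,p),\Delta t)$ or both are not defined. (Hamiltonians are understood to be smooth, so that these derivatives exist.) Consistent: $\Phi$ is consistent at $(q,p)$ for the Hamiltonian $H$ with flow $S^t$ if $\lim_{\Delta t\to 0}\|S^{\Delta t}(q,p)-\Phi(H,(q,p),\Delta t)\|/\Delta t=0$ (limit over $\Delta t>0$). Energy conservation: $H(\Phi(H,(q,p),\Delta t))=H(q,p)$. Volume conservation of a map $\Psi$ on $U$: $\mathrm{vol}(\Psi(A))=\mathrm{vol}(A)$ for all bounded open $A\subset U$. $C_0^\infty$ means smooth with compact support. *)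

(* Defs.v *)
(* Library: Mathematical Components + MathComp-Analysis. *)
From mathcomp Require Import all_boot all_order all_algebra.
From mathcomp Require Import all_classical all_reals all_analysis.

Set Implicit Arguments.
Unset Strict Implicit.
Unset Printing Implicit Defensive.

Import Order.TTheory GRing.Theory Num.Theory.
Import numFieldNormedType.Exports.

Local Open Scope classical_set_scope.
Local Open Scope ring_scope.

Definition partial (R : realType) (m : nat) (i : 'I_m)
    (f : 'rV[R]_m -> R) : 'rV[R]_m -> R :=
  fun x => 'D_(delta_mx 0 i) f x.

(* [foldr] makes the derivatives in the coordinate of lowest index outermost. *)
Definition mpartial (R : realType) (m : nat) (alpha : 'I_m -> nat)
    (f : 'rV[R]_m -> R) : 'rV[R]_m -> R :=
  foldr (fun i g => iter (alpha i) (partial i) g) f (enum 'I_m).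

(* C^oo: the partial derivatives of all orders, taken in any order of the
   variables, exist and are continuous. *)
Definition smooth (R : realType) (m : nat) (f : 'rV[R]_m -> R) : Prop :=
  forall s : seq 'I_m,
    continuous (foldr (@partial R m) f s) /\
    forall (i : 'I_m) (x : 'rV[R]_m),
      derivable (foldr (@partial R m) f s) x (delta_mx 0 i).

Definition smooth_compact_support (R : realType) (V : R -> R) : Prop :=
  (forall (k : nat) (x : R), derivable (derive1n k V) x 1) /\
  compact (closure [set x | V x != 0]).

Definition box (R : realType) (m : nat) (ab : 'rV[R]_m * 'rV[R]_m) :
    set 'rV[R]_m :=
  [set x | forall i, ab.1 0 i <= x 0 i <= ab.2 0 i].

Definition box_volume (R : realType) (m : nat)
    (ab : 'rV[R]_m * 'rV[R]_m) : R :=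
  \prod_(i < m) (ab.2 0 i - ab.1 0 i).

(* m-dimensional Lebesgue outer measure. It is the Lebesgue measure on
   measurable sets, in particular on open sets and on their images under
   continuous maps, which are countable unions of compact sets. *)
Definition volume (R : realType) (m : nat) (A : set 'rV[R]_m) : \bar R :=
  ereal_inf
    [set (\sum_(0 <= k <oo) (box_volume (B k))%:E)%E | B in
      [set B : nat -> 'rV[R]_m * 'rV[R]_m |
        (forall k i, (B k).1 0 i <= (B k).2 0 i) /\
        A `<=` \bigcup_k box (B k)]].

(* The point (q, p) of R^(2n) is [row_mx q p]. *)
Definition qcoord (R : realType) (n : nat) (z : 'rV[R]_(n + n)) (i : 'I_n) : R :=
  z 0 (lshift n i).

Definition pcoord (R : realType) (n : nat) (z : 'rV[R]_(n + n)) (i : 'I_n) : R :=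
  z 0 (rshift n i).

Definition phase_proj (R : realType) (n : nat) (i : 'I_n) (z : 'rV[R]_(n + n)) :
    'rV[R]_(1 + 1) :=
  row_mx (const_mx (qcoord z i)) (const_mx (pcoord z i)).

(* [None] means "not defined". Hamiltonians are smooth and steps nonnegative;
   the values of an integrator at other arguments are irrelevant, and every
   property below only constrains smooth Hamiltonians and steps >= 0. *)
Definition integrator (R : realType) (n : nat) : Type :=
  ('rV[R]_(n + n) -> R) -> 'rV[R]_(n + n) -> R -> option 'rV[R]_(n + n).

Definition is_flow (R : realType) (n : nat) (H : 'rV[R]_(n + n) -> R)
    (S : R -> 'rV[R]_(n + n) -> 'rV[R]_(n + n)) : Prop :=
  (forall z, S 0 z = z) /\
  forall (z : 'rV[R]_(n + n)) (t : R) (i : 'I_n),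
    is_derive t 1 (fun s => qcoord (S s z) i)
      (partial (rshift n i) H (S t z)) /\
    is_derive t 1 (fun s => pcoord (S s z) i)
      (- partial (lshift n i) H (S t z)).

(* The existence of the limit includes that the integrator is defined for all
   sufficiently small steps, so that the default value 0 is not used. *)
Definition consistent_at (R : realType) (n : nat) (Phi : integrator R n)
    (H : 'rV[R]_(n + n) -> R)
    (S : R -> 'rV[R]_(n + n) -> 'rV[R]_(n + n)) (z : 'rV[R]_(n + n)) : Prop :=
  (\forall dt \near 0^'+, Phi H z dt != None) /\
  (fun dt : R => `|S dt z - odflt 0 (Phi H z dt)| / dt) @ 0^'+ --> (0 : R).

Definition computationally_reasonable (R : realType) (n : nat)
    (Phi : integrator R n) : Prop :=
  forall (H : 'rV[R]_(n + n) -> R) (z : 'rV[R]_(n + n)) (dt : R),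
    smooth H -> 0 <= dt ->
    exists (m : nat) (r : 'I_m -> 'rV[R]_(n + n))
           (alpha : 'I_m -> 'I_(n + n) -> nat),
      forall H' : 'rV[R]_(n + n) -> R, smooth H' ->
        (forall j, mpartial (alpha j) H' (r j) = mpartial (alpha j) H (r j)) ->
        Phi H z dt = Phi H' z dt.

Definition conserves_energy (R : realType) (n : nat)
    (Phi : integrator R n) : Prop :=
  forall (H : 'rV[R]_(n + n) -> R) (z w : 'rV[R]_(n + n)) (dt : R),
    smooth H -> 0 <= dt -> Phi H z dt = Some w -> H w = H z.

Definition respects_decoupling (R : realType) (n : nat)
    (Phi : integrator R n) : Prop :=
  forall (G : 'rV[R]_(n + n) -> R) (h : 'rV[R]_(1 + 1) -> R),
    smooth G -> (forall z, G z = \sum_(i < n) h (phase_proj i z)) ->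
    exists phi : integrator R 1,
      forall (z w : 'rV[R]_(n + n)) (dt : R),
        0 <= dt -> Phi G z dt = Some w ->
        forall i : 'I_n, phi h (phase_proj i z) dt = Some (phase_proj i w).

Definition defined_on (R : realType) (m : nat) (U : set 'rV[R]_m)
    (Psi : 'rV[R]_m -> option 'rV[R]_m) : Prop :=
  forall z, U z -> Psi z != None.

(* To be used for [Psi] defined on the open set [U]. *)
Definition continuous_on (R : realType) (m : nat) (U : set 'rV[R]_m)
    (Psi : 'rV[R]_m -> option 'rV[R]_m) : Prop :=
  forall z, U z -> {for z, continuous (fun x => odflt 0 (Psi x))}.

Definition conserves_volume_on (R : realType) (m : nat) (U : set 'rV[R]_m)
    (Psi : 'rV[R]_m -> option 'rV[R]_m) : Prop :=
  forall A : set 'rV[R]_m, open A -> bounded_set A -> A `<=` U ->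
    volume [set w | exists2 z, A z & Psi z = Some w] = volume A.

Definition defined_continuous_volume_conserving (R : realType) (m : nat)
    (U : set 'rV[R]_m) (Psi : 'rV[R]_m -> option 'rV[R]_m) : Prop :=
  [/\ defined_on U Psi, continuous_on U Psi & conserves_volume_on U Psi].

Definition free_hamiltonian (R : realType) (n : nat)
    (z : 'rV[R]_(n + n)) : R :=
  \sum_(i < n) pcoord z i ^+ 2 / 2.

Definition potential_hamiltonian (R : realType) (n : nat) (V : R -> R)
    (z : 'rV[R]_(n + n)) : R :=
  \sum_(i < n) (pcoord z i ^+ 2 / 2 + V (qcoord z i)).

(* Main.v *)
(** By decoupling and energy conservation, on diagonal points near p = 1 the
    integrator with potential W induces a planar map (q, p) |-> (Q, P) with
    P^2 + 2 W(Q) = p^2 + 2 W(q), and volume conservation makes it preserve area.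
    Consider [a, b] where W = 0. The thin energy strip |p - 1| < d over [a, b]
    has area 2 d (b - a); its image contains, up to small ends, the strip of the
    same energies between Q(a, 1) and Q(b, 1), whose area per 2 d is about the
    travel time int (1 - 2 W)^(-1/2), at least int (1 + W) for W >= 0. Hence the
    travel time from Q(a, 1) to Q(b, 1) is at most b - a, first locally and then
    for any a < b.

    For W = 0 this says that Q(., 1) is 1-Lipschitz; as no area is lost, it is
    locally an isometry, and consistency at q = -1 and q = 0 excludes that it is
    everywhere decreasing. So there are a < b with Q(b) - Q(a) = b - a and
    Q(b) > b. Put a small bump V >= 0 between max(b, Q(a)) and Q(b), away from
    the finitely many positions which determine the images of the diagonal
    points over a and b. For every lam in (0, 1] the integrator sends these two
    points to the same images as before, but the travel time between the images
    is now larger than b - a. *)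
Require Import Defs.
From mathcomp Require Import all_boot all_order all_algebra.
From mathcomp Require Import all_classical all_reals all_analysis.
From mathcomp Require Import measurable_realfun ring lra.

Import Order.TTheory GRing.Theory Num.Theory.
Import numFieldNormedType.Exports.

Local Open Scope classical_set_scope.
Local Open Scope ring_scope.

Set Implicit Arguments.
Unset Strict Implicit.

(** * Smooth bump functions *)

Section Bump.
Variable R : realType.
Implicit Types (f g : R -> R) (x : R).

(** Index k stands for k + 1 derivatives. Each derivative is given as a witness instead of
    [derive1n], so that closure under sums, products and affine substitutions follows by induction
    on k. *)
Fixpoint Cdiff (k : nat) f : Prop :=
  if k is k'.+1 then
    exists2 f', forall x, is_derive x (1 : R) f (f' x) & Cdiff k' f'
  else forall x, derivable f x 1.

Lemma Cdiff_derivable1n k f : Cdiff k f -> forall x, derivable (derive1n k f) x 1.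
Proof.
elim: k f => [//|k IH] f [f' df /IH] h x; rewrite derive1Sn.
suff -> : f^`()%classic = f' by exact: h.
by apply/funext => y; rewrite derive1E; exact: derive_val.
Qed.

Lemma Cdiff_pred k f : Cdiff k.+1 f -> Cdiff k f.
Proof.
elim: k f => [|k IH] f /= [f' df h]; first by move=> x; case: (df x).
by exists f' => //; exact: IH.
Qed.

Lemma CdiffD k f g : Cdiff k f -> Cdiff k g -> Cdiff k (f + g).
Proof.
elim: k f g => [|k IH] f g /=; first by move=> hf hg x; exact: derivableD.
move=> [f' df hf] [g' dg hg]; exists (f' + g'); last exact: IH.
by move=> x; have := df x; have := dg x => *; exact: is_deriveD.
Qed.

Lemma CdiffM k f g : Cdiff k f -> Cdiff k g -> Cdiff k (f * g).
Proof.
elim: k f g => [|k IH] f g; first by move=> hf hg x; exact: derivableM.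
move=> Hf Hg; have := Hf; have := Hg; move=> [g' dg hg] [f' df hf].
exists (f * g' + g * f').
  by move=> x; have := df x; have := dg x => *; exact: is_deriveM.
by apply: CdiffD; apply: IH => //; exact: Cdiff_pred.
Qed.

Lemma Cdiff_cst k (c : R) : Cdiff k (cst c).
Proof.
elim: k c => [|k IH] c; first by move=> x; exact: derivable_cst.
by exists (cst 0) => // x; exact: is_derive_cst.
Qed.

Lemma Cdiff_affine k f (a b : R) : Cdiff k f -> Cdiff k (fun x => f (a * x + b)).
Proof.
elim: k f => [|k IH] f.
  move=> hf x; have /derivableP h := hf (a * x + b).
  have H : is_derive x (1 : R) (fun x => a * x + b) a.
    by apply: is_derive_eq; rewrite addr0 /GRing.scale/= mulr1.
  by have [] := is_derive1_comp (g := fun x => a * x + b) h H.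
move=> [f' df hf]; exists ((fun x => f' (a * x + b)) * cst a); last first.
  by apply: CdiffM; [exact: IH | exact: Cdiff_cst].
move=> x.
have H : is_derive x (1 : R) (fun x => a * x + b) a.
  by apply: is_derive_eq; rewrite addr0 /GRing.scale/= mulr1.
exact: (is_derive1_comp (g := fun x => a * x + b) (df _) H).
Qed.

(** The classical flat function exp(-1/x), extended by 0 to x <= 0, times x^(-n). The powers are
    included because differentiation then stays within linear combinations of the family. *)
Definition flat n x : R := if 0 < x then x^-1 ^+ n * expR (- x^-1) else 0.

Lemma flat_ge0 n x : 0 <= flat n x.
Proof.
rewrite /flat; case: ifPn => // x0.
by rewrite mulr_ge0 ?expR_ge0 // exprn_ge0 // invr_ge0 ltW.
Qed.

(** For t = 1/x > 0 the exponential series gives e^t >= t^(n+2) / (n+2)!. A quadratic bound is what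
    makes the derivative at 0 vanish. *)
Lemma flat_le n x : flat n x <= n.+2`!%:R * x ^+ 2.
Proof.
rewrite /flat; case: ifPn => x0; last by rewrite mulr_ge0 // sqr_ge0.
rewrite expRN ler_pdivrMr ?expR_gt0 //.
have t0 : 0 <= x^-1 by rewrite invr_ge0 ltW.
have := expR_ge1Dxn n.+1 t0.
set E := expR _ => h.
have {}h : x^-1 ^+ n.+2 / n.+2`!%:R <= E by rewrite (le_trans _ h)// lerDr.
have F0 : (0 : R) < n.+2`!%:R by rewrite ltr0n fact_gt0.
rewrite ler_pdivrMr // in h.
move: n.+2`!%:R F0 h => F F0 h.
have -> : x^-1 ^+ n = x ^+ 2 * x^-1 ^+ n.+2.
  by rewrite !exprS expr0; field; rewrite gt_eqF.
have -> : F * x ^+ 2 * E = x ^+ 2 * (E * F) by ring.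
exact: ler_wpM2l (sqr_ge0 x) _ _ h.
Qed.

Lemma is_derive0_quadratic f (C : R) : f 0 = 0 -> 0 <= C ->
  (forall x, `|f x| <= C * x ^+ 2) -> is_derive (0 : R) (1 : R) f 0.
Proof.
move=> f0 C0 hf.
suff h : (fun h : R => h^-1 *: (f (h *: 1 + 0) - f 0)) @ 0^' --> (0 : R).
  apply: DeriveDef; first by apply/cvg_ex; exists 0; exact: h.
  exact/cvg_lim.
apply/cvgrPdist_le => e e0.
near=> h.
rewrite f0 sub0r normrN subr0 addr0 /GRing.scale /= mulr1 normrM normfV.
have h0 : 0 < `|h| by rewrite normr_gt0; near: h; exact: nbhs_dnbhs_neq.
rewrite mulrC ler_pdivrMr //; apply: (le_trans (hf h)).
rewrite -normr_id -(ger0_norm (sqr_ge0 h)) normrX !normr_id expr2 mulrA ler_wpM2r //.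
(* Dividing by C + 1 also covers C = 0. *)
have -> : e = (C + 1) * (e / (C + 1)) by rewrite mulrC divfK // gt_eqF // ltr_wpDl.
apply: ler_pM => //; first by rewrite lerDl.
near: h; apply: nbhs_dnbhs; near=> h.
apply: ltW; near: h.
apply: (@nbhs0_lt R R); by rewrite divr_gt0 // ltr_wpDl.
Unshelve. all: by end_near. Qed.

(** Away from 0 this is the product and chain rule on either branch; at 0 all terms vanish and the
    quadratic bound applies. *)
Lemma is_derive_flat n x :
  is_derive x (1 : R) (flat n) (flat n.+2 x - n%:R * flat n.+1 x).
Proof.
have [x0|x0|->] := ltgtP x 0.
- apply: (@near_eq_is_derive _ _ _ (cst 0)).
    near=> y; rewrite /flat ifN // -leNgt ltW //; near: y; exact: lt_nbhsl.
  by rewrite /flat !(lt_gtF x0) mulr0 subr0; exact: is_derive_cst.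
- apply: (@near_eq_is_derive _ _ _ ((fun y => y^-1 ^+ n) * (fun y => expR (- y^-1)))).
    near=> y; rewrite /flat ifT //; near: y; exact: lt_nbhsr.
  rewrite /flat x0.
  have dV : is_derive x (1:R) (fun y : R => y^-1) (- x ^- 2).
    apply: is_derive_eq; first by apply: is_deriveV; rewrite gt_eqF.
    by rewrite /GRing.scale/= mulr1.
  have dX : is_derive x (1:R) (fun y : R => y^-1 ^+ n) (n%:R * x^-1 ^+ n.-1 * - x ^- 2).
    rewrite -[X in is_derive _ _ X](exprfctE (fun y : R => y^-1) n).
    exact: (is_deriveX n dV).
  have dE : is_derive x (1:R) (fun y : R => expR (- y^-1)) (expR (- x^-1) * x ^- 2).
    apply: (@is_derive1_comp _ expR (fun y => - y^-1)).
    by have := is_deriveN dV; rewrite opprK.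
  apply: (is_derive_eq (is_deriveM dX dE)).
  rewrite /GRing.scale /=.
  case: n dX => [|n] _ /=; rewrite ?exprS ?expr0; field; rewrite gt_eqF //.
- have -> : flat n.+2 0 - n%:R * flat n.+1 0 = 0 by rewrite /flat ltxx mulr0 subr0.
  apply: (@is_derive0_quadratic _ n.+2`!%:R) => //; first by rewrite /flat ltxx.
  by move=> y; rewrite ger0_norm ?flat_ge0 // flat_le.
Unshelve. all: by end_near. Qed.

Lemma Cdiff_flat k n : Cdiff k (flat n).
Proof.
elim: k n => [|k IH] n; first by move=> x; case: (is_derive_flat n x).
exists (flat n.+2 + cst (- n%:R) * flat n.+1).
  move=> x; apply: is_derive_eq; first exact: is_derive_flat.
  by rewrite -mulNr.
by apply: CdiffD => //; apply: CdiffM => //; exact: Cdiff_cst.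
Qed.

End Bump.

Section Smooth.
Variable R : realType.
Implicit Types (f g : R -> R) (x : R).

Definition Cinf f := forall k, Cdiff k f.

Lemma Cinf_derive1 f : Cinf f ->
  (forall x, is_derive x (1 : R) f (f^`()%classic x)) /\ Cinf f^`()%classic.
Proof.
move=> hf; have [f' df _] := hf 1%N.
have e : f^`()%classic = f'.
  by apply/funext => y; rewrite derive1E; exact: derive_val.
split=> [x|k]; first by rewrite e.
have [f'' df' h] := hf k.+1.
suff -> : f^`()%classic = f'' by [].
by apply/funext => y; rewrite derive1E; exact: derive_val.
Qed.

Lemma CinfM f g : Cinf f -> Cinf g -> Cinf (f * g).
Proof. by move=> hf hg k; exact: CdiffM. Qed.

Lemma Cinf_cst (c : R) : Cinf (cst c).
Proof. by move=> k; exact: Cdiff_cst. Qed.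

Lemma Cinf_id : Cinf id.
Proof. move=> [|k]; first by move=> x; exact: derivable_id.
exists (cst 1); last exact: Cdiff_cst. by move=> x; exact: is_derive_id. Qed.

Lemma Cinf_continuous f : Cinf f -> continuous f.
Proof.
by move=> /(_ 0%N) hf x; apply: differentiable_continuous; exact/derivable1_diffP.
Qed.

Lemma smooth_compact_support_Cinf (V : R -> R) (a b : R) : Cinf V ->
  (forall x, ~~ (a < x < b) -> V x = 0) -> smooth_compact_support V.
Proof.
move=> hV V0; split=> [k x|]; first exact: (Cdiff_derivable1n (hV k)).
apply: (@subclosed_compact _ _ `[a, b]); first exact: closed_closure.
  exact: segment_compact.
have cl : closed `[a, b]%classic by exact: interval_closed.
apply: subset_trans cl; apply: closure_subset => x /= /eqP Vx; rewrite in_itv/=.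
have [/andP[/ltW-> /ltW->]//|n] := boolP (a < x < b).
by case: Vx; exact: V0.
Qed.

Lemma flat0_le1 x : flat 0 x <= 1.
Proof.
rewrite /flat; case: ifPn => // x0.
by rewrite expr0 mul1r -expR0 ler_expR oppr_le0 invr_ge0 ltW.
Qed.

Lemma flat0_homo x y : x <= y -> flat 0 x <= flat 0 y.
Proof.
move=> xy; rewrite {1}/flat; case: ifPn => [x0|_]; last exact: flat_ge0.
rewrite /flat (lt_le_trans x0 xy) !expr0 !mul1r ler_expR lerN2.
by rewrite lef_pV2 // posrE // (lt_le_trans x0 xy).
Qed.

Lemma flat0_gt0 x : 0 < x -> 0 < flat 0 x.
Proof. by move=> x0; rewrite /flat x0 expr0 mul1r expR_gt0. Qed.

(** The bump is exp(-1/(x - a)) exp(-1/(b - x)) / 8, and [j1, j2] is the middle third, where both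
    factors are at least their value at (b - a)/3. The bound 1/8 keeps the potential well below the
    energies near 1/2 used later. *)
Lemma bump_exists (a b : R) : a < b -> exists V : R -> R,
  [/\ Cinf V, (forall x, 0 <= V x <= 8^-1), (forall x, ~~ (a < x < b) -> V x = 0) &
    exists j1 j2 k : R, [/\ a < j1, j1 < j2, j2 < b, 0 < k &
      forall x, j1 <= x <= j2 -> k <= V x]].
Proof.
move=> ab.
pose V x := 8^-1 * (flat 0 (1 * x + (- a)) * flat 0 (-1 * x + b)).
exists V; split.
- move=> k; apply: (@CdiffM _ k (cst 8^-1)); first exact: Cdiff_cst.
  apply: (@CdiffM _ k (fun x => flat 0 (1 * x + (- a)))).
    by apply: Cdiff_affine; exact: Cdiff_flat.
  by apply: Cdiff_affine; exact: Cdiff_flat.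
- move=> x; rewrite /V; apply/andP; split.
    by rewrite !mulr_ge0 // flat_ge0.
  by rewrite ger_pMr // mulr_ile1 // ?flat_ge0 // flat0_le1.
- move=> x; rewrite negb_and -!leNgt => /orP[xa|bx]; rewrite /V.
    by rewrite {1}/flat ltNge mul1r subr_le0 xa /= mul0r mulr0.
  by rewrite (_ : flat 0 (-1 * x + b) = 0) ?mulr0 // /flat ltNge mulN1r addrC subr_le0 bx.
- pose l := (b - a) / 3.
  have l0 : 0 < l by rewrite divr_gt0 // subr_gt0.
  have e : b - a = 3 * l by rewrite /l; field.
  exists (a + l), (b - l), (8^-1 * (flat 0 l * flat 0 l)); split; try lra.
    by rewrite !mulr_gt0 // flat0_gt0.
  move=> x /andP[x1 x2]; rewrite /V ler_wpM2l // ler_pM ?flat_ge0 // flat0_homo //; lra.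
Qed.

End Smooth.

(** * Smoothness of separable functions *)

Section SmoothSum.
Variables (R : realType) (m : nat).
Implicit Types (z v : 'rV[R]_m).

(** The difference quotients of both functions are literally the same. *)
Lemma is_derive_coord (g : R -> R) z v j d :
  is_derive (z 0 j) (v 0 j) g d -> is_derive z v (fun z => g (z 0 j)) d.
Proof.
move=> [h1 h2].
have e : (fun h : R => h^-1 *: (((fun z => g (z 0 j)) \o shift z) (h *: v) - g (z 0 j))) =
  (fun h => h^-1 *: ((g \o shift (z 0 j)) (h *: v 0 j) - g (z 0 j))).
  by apply/funext => h /=; rewrite !mxE.
by apply: DeriveDef; rewrite /derivable /derive e.
Qed.

Definition coord_sum (g : 'I_m -> R -> R) z := \sum_(j < m) g j (z 0 j).

Lemma is_derive_coord_sum (g : 'I_m -> R -> R) i z : (forall j, Cinf (g j)) ->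
  is_derive z (delta_mx 0 i) (coord_sum g) ((g i)^`()%classic (z 0 i)).
Proof.
move=> hg.
have e : coord_sum g = \sum_(j < m) (fun z => g j (z 0 j)).
  by apply/funext => y; rewrite /coord_sum fct_sumE.
rewrite e.
have H j : is_derive z (delta_mx 0 i) (fun z => g j (z 0 j))
    (if j == i then (g i)^`()%classic (z 0 i) else 0).
  apply: is_derive_coord; rewrite mxE eqxx /=.
  case: eqP => [->|_]; first by have [] := Cinf_derive1 (hg i).
  exact: is_derive0.
have := is_derive_sum H.
by rewrite -big_mkcond /= big_pred1_eq.
Qed.

(** A partial derivative of a coordinate sum is again a coordinate sum, with all terms but one
    replaced by 0; so every iterated derivative has this form. *)
Lemma smooth_coord_sum (g : 'I_m -> R -> R) : (forall j, Cinf (g j)) ->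
  smooth (coord_sum g).
Proof.
move=> hg s.
have [g' hg' ->] : exists2 g', (forall j, Cinf (g' j)) &
    foldr (@partial R m) (coord_sum g) s = coord_sum g'.
  elim: s => [|i s [g' hg' IH]] /=; first by exists g.
  rewrite IH; exists (fun j => if j == i then (g' i)^`()%classic else cst 0).
    move=> j; case: eqP => _; last exact: Cinf_cst.
    by have [] := Cinf_derive1 (hg' i).
  apply/funext => z; rewrite /partial.
  rewrite (@derive_val _ _ _ _ _ _ _ (is_derive_coord_sum i z hg')).
  rewrite /coord_sum (bigD1 i) //= eqxx big1 ?addr0 // => j /negPf ->.
  by [].
split=> [|i z]; last by have [] := is_derive_coord_sum i z hg'.
apply: (@continuous_big R _ +%R 0 xpredT add_continuous _ _
  (fun j z => g' j (z 0 j))) => j _ z.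
apply: (@continuous_comp _ _ _ (fun z => z 0 j) (g' j)).
  exact: coord_continuous.
exact: Cinf_continuous.
Qed.

Lemma near_partial f g i z : (\near z, f z = g z) ->
  \near z, @partial R m i f z = partial i g z.
Proof.
move=> /near_join; apply: filterS => y h.
exact: near_eq_derive.
Qed.

Lemma near_mpartial (alpha : 'I_m -> nat) f g z : (\near z, f z = g z) ->
  mpartial alpha f z = @mpartial R m alpha g z.
Proof.
(* The induction must carry equality on a neighbourhood, not only at z, since every further
   derivative needs it. *)
move=> h; apply: (@nbhs_singleton _ z (fun z => mpartial alpha f z = mpartial alpha g z)).
rewrite /mpartial; elim: (enum _) => [//|i s IH] /=.
elim: (alpha i) => [//|k IHk] /=.
exact: near_partial.
Qed.

End SmoothSum.

(** * Volumes of products of planar sets *)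

Section IteratedCover.
Context d (T : measurableType d) (R : realType) (mu : {measure set T -> \bar R}).
Local Open Scope ereal_scope.

(* Integrating one variable at a time; C and v carry the factors that have
   already been integrated. *)
Lemma iterated_cover (n : nat) (s : set T) (c : nat -> nat -> set T)
    (C : \bar R) (v : nat -> \bar R) (t0 : T) :
  measurable s -> (forall k i, measurable (c k i)) ->
  0 <= C -> (forall k, 0 <= v k) ->
  (forall z : nat -> T, (forall i, (i < n)%N -> s (z i)) ->
    C <= \sum_(0 <= k <oo) (v k * (\prod_(0 <= i < n) \1_(c k i) (z i))%:E)) ->
  C * mu s ^+ n <= \sum_(0 <= k <oo) (v k * \prod_(0 <= i < n) mu (c k i)).
Proof.
move=> ms mc; elim: n C v => [|n IH] C v C0 v0 H.
  rewrite expe0 mule1; have := H (fun=> t0) => /(_ _)/le_trans; apply => //.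
  apply: lee_nneseries => [k _ _|k _]; first by rewrite mule_ge0 // big_geq.
  by rewrite !big_geq // mule1.
rewrite expeS muleA.
under eq_eseriesr do rewrite big_nat_recr //= [X in _ * X]muleC muleA.
apply: IH => [|k|z hz]; [exact: mule_ge0|exact: mule_ge0|].
(* With the other variables fixed, the covering inequality is integrated over the last variable x in
   s; [z'] puts x at index n. *)
rewrite -integral_cst //.
pose z' x i := if (i < n)%N then z i else x.
have z'E x k : (\prod_(0 <= i < n.+1) \1_(c k i) (z' x i) =
    (\prod_(0 <= i < n) \1_(c k i) (z i)) * \1_(c k n) x :> R)%R.
  rewrite big_nat_recr //= /z' ltnn; congr (_ * _)%R.
  by apply: eq_big_nat => i /andP[_ ->].
have p0 k : (0 <= \prod_(0 <= i < n) \1_(c k i) (z i) :> R)%R.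
  by apply: prodr_ge0 => i _; rewrite indicE.
pose f k : T -> \bar R :=
  fun x => v k * (\prod_(0 <= i < n) \1_(c k i) (z i))%:E * (\1_(c k n) x)%:E.
have mf k : measurable_fun s (f k).
  apply: emeasurable_funM => //.
  by apply/measurable_EFinP; exact: measurable_indic.
have f0 k x : 0 <= f k x.
  by rewrite mule_ge0 ?mule_ge0 ?lee_fin // indicE.
apply: (@le_trans _ _ (\int[mu]_(x in s) \sum_(0 <= k <oo) f k x)).
  apply: ge0_le_integral => //.
    by apply: ge0_emeasurable_sum => // k x *; exact: f0.
  move=> x sx.
  have := H (z' x) => /(_ _)/le_trans; apply.
    by move=> i _; rewrite /z'; case: ifP => // /hz.
  apply: lee_nneseries => [k _ _|k _]; last by rewrite z'E EFinM muleA.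
  by rewrite mule_ge0 // lee_fin prodr_ge0 // => i _; rewrite indicE.
rewrite integral_nneseries //.
apply: lee_nneseries => [k _ _|k _]; first by apply: integral_ge0 => x _; exact: f0.
rewrite ge0_integralZl //; last by rewrite mule_ge0 // lee_fin p0.
- rewrite integral_indic // [leRHS]muleAC.
  apply: lee_wpmul2l; first by rewrite mule_ge0 // lee_fin p0.
  by apply: le_measure; rewrite ?inE //; exact: measurableI.
- by apply/measurable_EFinP; exact: measurable_indic.
Qed.
End IteratedCover.

Local Notation plane R := (measurableTypeR R * measurableTypeR R)%type.

Section Volume.
Variable R : realType.

Definition area : {measure set (plane R) -> \bar R} :=
  (@lebesgue_measure R \x @lebesgue_measure R)%E.

Lemma area_rect (a b c d : R) : a <= b -> c <= d ->
  area (`[a, b]%classic `*` `[c, d]%classic) = ((b - a) * (d - c))%:E.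
Proof.
move=> ab cd; rewrite [LHS]product_measure1E; [|exact: measurable_itv..].
have H (x y : R) : x <= y -> lebesgue_measure (`[x, y]%classic : set R) = (y - x)%:E.
  move=> xy; rewrite lebesgue_measure_itv /= lte_fin.
  have [_|yx] := ltP x y; first by rewrite EFinN EFinB.
  by have -> : x = y by [apply/eqP; rewrite eq_le xy yx]; rewrite subrr.
by rewrite EFinM; congr (_ * _)%E; exact: H.
Qed.

Lemma box_volume_split n (B : 'rV[R]_(n + n) * 'rV[R]_(n + n)) :
  box_volume B =
    \prod_(i < n) ((qcoord B.2 i - qcoord B.1 i) * (pcoord B.2 i - pcoord B.1 i)).
Proof. by rewrite /box_volume big_split_ord /= -big_split. Qed.

(** Every box is a product of n planar rectangles, one per pair (q_i, p_i). The boxes cover the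
    product of n copies of s, so [iterated_cover] with planar area bounds their total volume from
    below. *)
Lemma volume_prod_ge n (s : set (plane R)) : measurable s ->
  (area s ^+ n <=
    volume [set z : 'rV[R]_(n + n) | forall i, s (qcoord z i, pcoord z i)])%E.
Proof.
move=> ms; apply: le_ereal_inf_tmp => _ [B [hB cover] <-].
pose c k i : set (plane R) :=
  if @idP (i < n)%N is ReflectT h then
  `[qcoord (B k).1 (Ordinal h), qcoord (B k).2 (Ordinal h)]%classic `*`
  `[pcoord (B k).1 (Ordinal h), pcoord (B k).2 (Ordinal h)]%classic else set0.
have cE k (i : 'I_n) : c k i = `[qcoord (B k).1 i, qcoord (B k).2 i]%classic `*`
   `[pcoord (B k).1 i, pcoord (B k).2 i]%classic.
  rewrite /c; case: {-}_ / idP => h; last by rewrite ltn_ord in h.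
  by rewrite (_ : Ordinal h = i) //; exact: val_inj.
have mc k i : measurable (c k i).
  rewrite /c; case: {-}_ / idP => h //.
  by apply: measurableX; exact: measurable_itv.
have BE k : (box_volume (B k))%:E = (1 * \prod_(0 <= i < n) area (c k i))%E.
  rewrite mul1e box_volume_split big_mkord.
  rewrite (big_morph EFin (@EFinM R) erefl); apply: eq_bigr => i _.
  by rewrite cE area_rect //; exact: hB.
under eq_eseriesr do rewrite BE.
rewrite -[leLHS]mul1e.
apply: iterated_cover => //; first exact: (0, 0).
move=> z hz.
pose w : 'rV[R]_(n + n) := row_mx (\row_(i < n) (z i).1) (\row_(i < n) (z i).2).
have qw i : qcoord w i = (z i).1 by rewrite /qcoord row_mxEl mxE.
have pw i : pcoord w i = (z i).2 by rewrite /pcoord row_mxEr mxE.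
have [k _ wk] : (\bigcup_k box (B k)) w.
  apply: cover => i; rewrite qw pw -surjective_pairing; exact: hz.
(* The box containing w contributes 1, so the partial sum up to its index k already suffices. *)
apply: (@le_trans _ _ (\sum_(0 <= j < k.+1)
  (1 * (\prod_(0 <= i < n) \1_(c j i) (z i))%:E))%E); last first.
  by apply: nneseries_lim_ge => j _; rewrite mul1e lee_fin prodr_ge0 // => i _; rewrite indicE.
rewrite big_nat_recr //= -[leLHS]add0e leeD //.
  by apply: sume_ge0 => j _; rewrite mul1e lee_fin prodr_ge0 // => i _; rewrite indicE.
rewrite mul1e lee_fin big_mkord big1 // => i _.
rewrite indicE mem_set // cE; split => /=; rewrite in_itv /=.
  by rewrite -qw; exact: wk.
by rewrite -pw; exact: wk.
Qed.

Lemma volume_le_box m (B : 'rV[R]_m * 'rV[R]_m) (A : set 'rV[R]_m) : (0 < m)%N ->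
  (forall i, B.1 0 i <= B.2 0 i) -> A `<=` box B -> (volume A <= (box_volume B)%:E)%E.
Proof.
move=> m0 hB AB.
(* The cover is padded with the degenerate box at 0; its volume is 0 because m > 0, an empty product
   being 1. *)
pose Bs (k : nat) : 'rV[R]_m * 'rV[R]_m := if k is 0 then B else (0, 0).
have -> : (box_volume B)%:E = (\sum_(0 <= k <oo) (box_volume (Bs k))%:E)%E.
  rewrite nneseries_recl //=; last first.
    move=> [|k] _; rewrite lee_fin; last by rewrite prodr_ge0 // => i _; rewrite subrr.
    by rewrite prodr_ge0 // => i _; rewrite subr_ge0.
  rewrite [X in (_ + X)%E]eseries0 ?adde0 // => -[//|k] _ _ /=.
  congr EFin; case: m m0 {B hB A AB Bs} => // m _.
  by rewrite /box_volume big_ord_recl /= subrr mul0r.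
apply: ereal_inf_lbound; exists Bs => //; split; first by case.
by move=> z /AB; exists 0.
Qed.

End Volume.

(** * Areas of energy strips *)

Section Strip.
Variable R : realType.

(** The point of [j1, j2] nearest to t, if j1 <= j2. For x <= y the difference of the values at y
    and x is the length of the part of [x, y] inside [j1, j2]. *)
Definition clip (j1 j2 t : R) := Num.max j1 (Num.min t j2).

Lemma clipP (j1 j2 t : R) : j1 <= j2 ->
  [\/ t <= j1 /\ clip j1 j2 t = j1, j1 <= t <= j2 /\ clip j1 j2 t = t |
     j2 <= t /\ clip j1 j2 t = j2].
Proof.
move=> j12; rewrite /clip; have [t2|t2] := leP t j2.
  have [t1|t1] := leP t j1; first by constructor 1.
  by constructor 2; rewrite (ltW t1).
by constructor 3; rewrite max_r // ltW.
Qed.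

(* The energies E with |sqrt(2 E) - 1| < d, on the branch p > 0. *)
Definition strip (W : R -> R) (x y d : R) : set (plane R) :=
  [set z | [/\ x < z.1 < y, 0 < z.2 &
    (1 - d) ^+ 2 < z.2 ^+ 2 + 2 * W z.1 < (1 + d) ^+ 2]].

Lemma measurable_strip (W : R -> R) (x y d : R) : continuous W -> measurable (strip W x y d).
Proof.
move=> cW.
have mf : measurable_fun setT
    (fun z : plane R => z.2 ^+ 2 + 2 * W z.1 : measurableTypeR R).
  apply: measurable_funD.
    by apply: measurable_funX; exact: measurable_snd.
  apply: measurable_funM => //.
  by apply: (measurableT_comp (continuous_measurable_fun cW)); exact: measurable_fst.
rewrite (_ : strip W x y d = (fst @^-1` `]x, y[%classic `&` snd @^-1` `]0, +oo[%classic) `&`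
   ((fun z => z.2 ^+ 2 + 2 * W z.1) @^-1` `](1 - d) ^+ 2, (1 + d) ^+ 2[%classic)).
  apply: measurableI; first apply: measurableI.
  - by rewrite -[_ @^-1` _]setTI; apply: measurable_fst => //; exact: measurable_itv.
  - by rewrite -[_ @^-1` _]setTI; apply: measurable_snd => //; exact: measurable_itv.
  - by rewrite -[_ @^-1` _]setTI; apply: mf => //; exact: measurable_itv.
apply/seteqP; split=> z /=; rewrite !in_itv/= ?andbT; first by case.
by move=> [[]].
Qed.

(** This is the width in p of the energy strip at potential w. The roots a and b satisfy a^2 - b^2 =
    4 d, and sqrt(A^2 - 2 w) <= A - w/A for A = 1 + d and A = 1 - d gives a + b <= 2 (1 - w). Hence
    a - b >= 2 d / (1 - w) >= 2 d (1 + w). *)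
Lemma sqrt_gap (w d : R) : 0 <= w <= 8^-1 -> 0 < d <= 4^-1 ->
  2 * d * (1 + w) <= Num.sqrt ((1 + d) ^+ 2 - 2 * w) - Num.sqrt ((1 - d) ^+ 2 - 2 * w).
Proof.
move=> /andP[w0 w1] /andP[d0 d1].
set a := Num.sqrt _; set b := Num.sqrt _.
have a2 : a ^+ 2 = (1 + d) ^+ 2 - 2 * w by rewrite sqr_sqrtr //; nra.
have b2 : b ^+ 2 = (1 - d) ^+ 2 - 2 * w by rewrite sqr_sqrtr //; nra.
have a0 : 0 < a by rewrite sqrtr_gt0; nra.
have b0 : 0 < b by rewrite sqrtr_gt0; nra.
have ha : a <= (1 + d) - w / (1 + d).
  have p : 0 < 1 + d by lra.
  have q : w / (1 + d) <= w by rewrite ler_pdivrMr //; nra.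
  rewrite -(@ler_pXn2r _ 2) // ?nnegrE ?(ltW a0) //; last by lra.
  have -> : (1 + d - w / (1 + d)) ^+ 2 = (1 + d) ^+ 2 - 2 * w + (w / (1 + d)) ^+ 2.
    by field; rewrite gt_eqF.
  by rewrite a2 lerDl sqr_ge0.
have hb : b <= (1 - d) - w / (1 - d).
  have p : 0 < 1 - d by lra.
  have q : w / (1 - d) <= 2 * w by rewrite ler_pdivrMr //; nra.
  rewrite -(@ler_pXn2r _ 2) // ?nnegrE ?(ltW b0) //; last by lra.
  have -> : (1 - d - w / (1 - d)) ^+ 2 = (1 - d) ^+ 2 - 2 * w + (w / (1 - d)) ^+ 2.
    by field; rewrite gt_eqF.
  by rewrite b2 lerDl sqr_ge0.
have hab : a + b <= 2 * (1 - w).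
  have e : w / (1 + d) + w / (1 - d) = 2 * w / (1 - d ^+ 2).
    by field; apply/andP; split; rewrite ?gt_eqF //; nra.
  have : 2 * w <= 2 * w / (1 - d ^+ 2).
    by rewrite ler_pdivlMr; nra.
  lra.
have ab : b < a by rewrite -(@ltr_pXn2r _ 2) ?nnegrE ?(ltW a0) ?(ltW b0) // a2 b2; nra.
have : (a - b) * (2 * (1 - w)) >= 4 * d.
  apply: (@le_trans _ _ ((a - b) * (a + b))).
    by rewrite -subr_sqr a2 b2; lra.
  by rewrite ler_pM2l // subr_gt0.
have -> : 4 * d = 2 * d * (2 * (1 + w) * (1 - w)) + 4 * d * w ^+ 2 by ring.
move=> h; rewrite -(@ler_pM2r _ (2 * (1 - w))); last lra.
have : 0 <= 4 * d * w ^+ 2 by rewrite mulr_ge0 ?sqr_ge0 //; lra.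
lra.
Qed.

(** The section over q is the open interval between the two roots of [sqrt_gap]. *)
Lemma section_strip_ge (W : R -> R) (x y d q : R) :
  0 <= W q <= 8^-1 -> 0 < d <= 4^-1 -> x < q < y ->
  ((2 * d * (1 + W q))%:E <= lebesgue_measure (xsection (strip W x y d) q))%E.
Proof.
move=> hW hd hq.
have gap := sqrt_gap hW hd.
set a := Num.sqrt _ in gap; set b := Num.sqrt _ in gap.
have ab : b < a.
  by rewrite -subr_gt0; apply: lt_le_trans gap; move: hW hd => /andP[? ?] /andP[? ?]; nra.
apply: (@le_trans _ _ (lebesgue_measure (`]b, a[%classic : set R))).
  by rewrite lebesgue_measure_itv /= lte_fin ab -EFinB lee_fin.
have b0 : 0 <= b by exact: sqrtr_ge0.
have h1 : 0 <= (1 - d) ^+ 2 - 2 * W q by move: hW hd => /andP[? ?] /andP[? ?]; nra.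
have h2 : 0 <= (1 + d) ^+ 2 - 2 * W q by move: hW hd => /andP[? ?] /andP[? ?]; nra.
rewrite (_ : xsection _ q = `]b, a[%classic) //.
apply/seteqP; split => p; rewrite /xsection /= inE /strip /= in_itv /=.
  move=> [_ p0 /andP[l u]].
  rewrite -(ltr_pXn2r (n := 2)) ?nnegrE ?(ltW p0) //.
  rewrite -[X in _ && X](ltr_pXn2r (n := 2)) ?nnegrE ?(ltW p0) ?sqrtr_ge0 //.
  by rewrite !sqr_sqrtr //; lra.
move=> /andP[bp pa]; have p0 : 0 < p by exact: le_lt_trans bp.
split=> //.
rewrite -(ltr_pXn2r (n := 2)) ?nnegrE ?(ltW p0) // sqr_sqrtr // in bp.
rewrite -(ltr_pXn2r (n := 2)) ?nnegrE ?(ltW p0) ?sqrtr_ge0 // sqr_sqrtr // in pa.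
lra.
Qed.

(** Integrate the section bound 2 d (1 + W), with W replaced by the smaller function that is k
    between the clipped endpoints and 0 elsewhere. *)
Lemma area_strip_ge (W : R -> R) (x y d j1 j2 k : R) :
  continuous W -> (forall q, 0 <= W q <= 8^-1) ->
  0 < d <= 4^-1 -> 0 <= k -> (forall q, j1 <= q <= j2 -> k <= W q) -> j1 <= j2 -> x <= y ->
  ((2 * d * ((y + k * clip j1 j2 y) - (x + k * clip j1 j2 x)))%:E <= area R (strip W x y d))%E.
Proof.
move=> cW hW hd k0 hk j12 xy.
have d0 : 0 <= 2 * d by move: hd => /andP[]; lra.
set u := clip j1 j2 y; set l := clip j1 j2 x.
have lu : l <= u.
  by rewrite /l /u; case: (clipP x j12) => -[? ->]; case: (clipP y j12) => -[? ->]; lra.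
(* When [x, y] misses [j1, j2] the clipped endpoints coincide and ]l, u[ is empty. *)
have Isub q : l < q < u -> x < q < y /\ j1 <= q <= j2.
  rewrite /l /u; case: (clipP x j12) => -[? ->];
    by case: (clipP y j12) => -[? ->] ?; split; lra.
have leb (s t : R) : s <= t -> lebesgue_measure (`]s, t[%classic : set R) = (t - s)%:E.
  move=> st; rewrite lebesgue_measure_itv /= lte_fin.
  have [_|ts] := ltP s t; first by rewrite EFinN EFinB.
  by have -> : s = t by [apply/eqP; rewrite eq_le st ts]; rewrite subrr.
have mi (s t : R) : measurable (`]s, t[%classic : set (measurableTypeR R)).
  exact: measurable_itv.
have mI (s t : R) : measurable_fun setT
    (\1_(`]s, t[%classic : set (measurableTypeR R)) : measurableTypeR R -> R).
  exact: measurable_indic.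
have intI (c s t : R) : 0 <= c -> s <= t ->
    (\int[lebesgue_measure]_q (c * \1_(`]s, t[%classic : set R) q)%:E = (c * (t - s))%:E)%E.
  move=> c0 st; under eq_integral do rewrite EFinM.
  rewrite ge0_integralZl //=; last first.
    by apply/measurable_EFinP; exact: mI.
  by rewrite integral_indic // setIT EFinM; congr (_ * _)%E; exact: leb.
have c0 (c s t : R) q : 0 <= c -> 0 <= c * \1_(`]s, t[%classic : set R) q.
  by move=> ?; rewrite mulr_ge0 // indicE.
have mc (c s t : R) : measurable_fun setT
    (fun q : measurableTypeR R => c * \1_(`]s, t[%classic : set R) q).
  by apply: measurable_funM => //; exact: mI.
have -> : ((2 * d * ((y + k * u) - (x + k * l)))%:E =
    \int[lebesgue_measure]_q ((2 * d) * \1_(`]x, y[%classic : set R) q +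
      (2 * d * k) * \1_(`]l, u[%classic : set R) q)%:E)%E.
  under eq_integral do rewrite EFinD.
  rewrite ge0_integralD //=.
  - by rewrite (intI _ _ _ d0 xy) (intI _ _ _ (mulr_ge0 d0 k0) lu) -EFinD; congr EFin; ring.
  - by move=> q _; rewrite lee_fin c0.
  - exact/measurable_EFinP.
  - by move=> q _; rewrite lee_fin (c0 _ _ _ _ (mulr_ge0 d0 k0)).
  - exact/measurable_EFinP.
apply: ge0_le_integral => //=.
- by move=> q _; rewrite lee_fin addr_ge0 ?(c0 _ _ _ _ d0) ?(c0 _ _ _ _ (mulr_ge0 d0 k0)).
- by apply/measurable_EFinP; apply: measurable_funD.
- by apply: measurable_fun_xsection; exact: measurable_strip.
- move=> q _; rewrite !indicE.
  have [xqy|n] := boolP (x < q < y).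
    apply: le_trans (section_strip_ge (hW q) hd xqy).
    rewrite lee_fin mem_set /= ?in_itv //= mulr1 mulrDr mulr1 lerD2l -mulrA ler_wpM2l //.
    case: (boolP (q \in _)) => [|_]; last by rewrite mulr0; have /andP[] := hW q.
    by rewrite inE /= in_itv /= mulr1 => /Isub[_]; exact: hk.
  have n' : ~~ (l < q < u) by apply: contra n => /Isub[].
  rewrite memNset; last by rewrite /= in_itv /=; exact/negP.
  rewrite memNset; last by rewrite /= in_itv /=; exact/negP.
  by rewrite !mulr0 addr0 measure_ge0.
Qed.
End Strip.

(** * Points, rectangles and strips in phase space *)

Lemma lee_expe (R : realType) (x y : \bar R) m :
  (0 <= x -> x <= y -> x ^+ m <= y ^+ m)%E.
Proof.
by move=> x0 xy; elim: m => [|m IH]; rewrite ?expe0 // !expeS lee_pmul // expe_ge0.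
Qed.

Section PhasePoints.
Variables (R : realType) (n : nat).
Implicit Types (z w : 'rV[R]_(n + n)) (q p : R).

Definition diag q p : 'rV[R]_(n + n) := row_mx (const_mx q) (const_mx p).

Lemma qcoord_row_mx (u v : 'rV[R]_n) i : qcoord (row_mx u v) i = u 0 i.
Proof. by rewrite /qcoord row_mxEl. Qed.

Lemma pcoord_row_mx (u v : 'rV[R]_n) i : pcoord (row_mx u v) i = v 0 i.
Proof. by rewrite /pcoord row_mxEr. Qed.

Lemma qcoord_diag q p i : qcoord (diag q p) i = q.
Proof. by rewrite qcoord_row_mx mxE. Qed.

Lemma pcoord_diag q p i : pcoord (diag q p) i = p.
Proof. by rewrite pcoord_row_mx mxE. Qed.

Lemma phase_ext z w : (forall i, qcoord z i = qcoord w i) ->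
  (forall i, pcoord z i = pcoord w i) -> z = w.
Proof.
move=> hq hp; apply/rowP => j; rewrite -[j]splitK; case: (fintype.split j) => i /=.
  exact: hq.
exact: hp.
Qed.

Lemma phase_proj_inj i j z w : phase_proj i z = phase_proj j w ->
  qcoord z i = qcoord w j /\ pcoord z i = pcoord w j.
Proof.
by move=> /eq_row_mx[/matrixP/(_ 0 0) + /matrixP/(_ 0 0)]; rewrite !mxE.
Qed.

Lemma phase_proj_eq i j z w : qcoord z i = qcoord w j ->
  pcoord z i = pcoord w j -> phase_proj i z = phase_proj j w.
Proof. by rewrite /phase_proj => -> ->. Qed.

Lemma nbhs_phase z (U : set 'rV[R]_(n + n)) : nbhs z U <->
  exists2 r, 0 < r & forall w,
    (forall i, `|qcoord w i - qcoord z i| < r /\ `|pcoord w i - pcoord z i| < r) -> U w.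
Proof.
split=> [/nbhs_ballP[r r0 h]|[r r0 h]].
  exists r => // w hw; apply: h; split=> // i j; rewrite ord1 -[j]splitK.
  rewrite /ball /= distrC; case: (fintype.split j) => k /=; have [] := hw k; done.
apply/nbhs_ballP; exists r => // w [_ hw]; apply: h => i.
by split; rewrite distrC; exact: hw.
Qed.

Lemma diag_continuous : continuous (fun z : R * R => diag z.1 z.2).
Proof.
move=> [q p] U /nbhs_phase[r r0 h].
apply/nbhs_ballP; exists r => // -[q' p'] [/= h1 h2]; apply: h => i.
by rewrite !qcoord_diag !pcoord_diag distrC; split=> //; rewrite distrC.
Qed.

Lemma qcoord_continuous (i : 'I_n) : continuous (fun z => qcoord z i).
Proof. exact: coord_continuous. Qed.

Lemma pcoord_continuous (i : 'I_n) : continuous (fun z => pcoord z i).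
Proof. exact: coord_continuous. Qed.

Definition phase_rect (a b c d : R) : set 'rV[R]_(n + n) :=
  [set z | forall i, a < qcoord z i < b /\ c < pcoord z i < d].

Lemma open_phase_rect a b c d : open (phase_rect a b c d).
Proof.
rewrite openE => z hz; rewrite /interior.
have H (f : 'rV[R]_(n + n) -> R) (x y : R) :
    continuous f -> x < f z < y -> \near z, x < f z < y.
  move=> cf /andP[h1 h2]; near=> w; apply/andP; split; near: w.
    exact: (cvgr_gt (f z) (cf z)).
  exact: (cvgr_lt (f z) (cf z)).
have h i : \near z, a < qcoord z i < b /\ c < pcoord z i < d.
  have [h1 h2] := hz i.
  by apply: filterI; [apply: (H (fun z => qcoord z i)) => //; exact: qcoord_continuous
    |apply: (H (fun z => pcoord z i)) => //; exact: pcoord_continuous].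
exact: (@filter_forall _ _ (fun i w => a < qcoord w i < b /\ c < pcoord w i < d)
  (nbhs z) (nbhs_filter z) h).
Unshelve. all: by end_near. Qed.

Lemma bounded_phase_rect a b c d : bounded_set (phase_rect a b c d).
Proof.
exists (`|a| + `|b| + `|c| + `|d|); split; first exact: num_real.
move=> M hM z hz /=; rewrite [leLHS]/Num.norm /= mx_normrE.
apply/bigmax_leP; split=> [|[i j] _ /=].
  by apply: le_trans (ltW hM); rewrite !addr_ge0.
rewrite ord1 -[j]splitK; apply: le_trans (ltW hM).
have := ler_norm a; have := ler_norm b; have := ler_norm c; have := ler_norm d.
have := ler_norm (- a); have := ler_norm (- b); have := ler_norm (- c); have := ler_norm (- d).
rewrite !normrN.
case: (fintype.split j) => k /=; have [/andP[h1 h2] /andP[h3 h4]] := hz k;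
  rewrite /qcoord /pcoord in h1 h2 h3 h4.
  by move=> *; rewrite ler_norml; lra.
by move=> *; rewrite ler_norml; lra.
Qed.

Lemma le_volume m (A B : set 'rV[R]_m) : A `<=` B -> (volume A <= volume B)%E.
Proof.
move=> AB; apply: ereal_inf_le_tmp => _ [C [hC BC] <-]; exists C => //; split => //.
exact: subset_trans BC.
Qed.

Lemma volume_phase_rect_le (A : set 'rV[R]_(n + n)) a b c d :
  (0 < n)%N -> a <= b -> c <= d ->
  (forall z, A z -> forall i, a <= qcoord z i <= b /\ c <= pcoord z i <= d) ->
  (volume A <= (((b - a) * (d - c)) ^+ n)%:E)%E.
Proof.
move=> n0 ab cd hA.
have := @volume_le_box R _ (diag a c, diag b d) A.
rewrite box_volume_split /=.
under eq_bigr do rewrite !qcoord_diag !pcoord_diag.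
rewrite prodr_const card_ord; apply; first by rewrite addn_gt0 n0.
  move=> j; rewrite -[j]splitK; case: (fintype.split j) => i /=.
    by have := qcoord_diag a c i; have := qcoord_diag b d i; rewrite /qcoord => -> ->.
  by have := pcoord_diag a c i; have := pcoord_diag b d i; rewrite /pcoord => -> ->.
move=> z /hA hz j /=; rewrite -[j]splitK; case: (fintype.split j) => i /=;
  have [h1 h2] := hz i.
  by have := qcoord_diag a c i; have := qcoord_diag b d i; rewrite /qcoord => -> ->.
by have := pcoord_diag a c i; have := pcoord_diag b d i; rewrite /pcoord => -> ->.
Qed.

Lemma volume_strip_ge (W : R -> R) (x y d j1 j2 k : R) (A : set 'rV[R]_(n + n)) :
  continuous W -> (forall q, 0 <= W q <= 8^-1) ->
  0 < d <= 4^-1 -> 0 <= k -> (forall q, j1 <= q <= j2 -> k <= W q) -> j1 <= j2 -> x <= y ->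
  (forall z, (forall i, strip W x y d (qcoord z i, pcoord z i)) -> A z) ->
  (((2 * d * ((y + k * clip j1 j2 y) - (x + k * clip j1 j2 x))) ^+ n)%:E <= volume A)%E.
Proof.
move=> cW hW hd k0 hk j12 xy hA.
apply: le_trans (le_volume hA).
apply: le_trans (volume_prod_ge n (measurable_strip x y d cW)).
have d0 : 0 < d by case/andP: hd.
have xy' : 0 <= 2 * d * ((y + k * clip j1 j2 y) - (x + k * clip j1 j2 x)).
  apply: mulr_ge0; first by lra.
  rewrite subr_ge0 lerD // ler_wpM2l //.
  by case: (clipP x j12) => -[? ->]; case: (clipP y j12) => -[? ->]; lra.
rewrite EFin_expe; apply: lee_expe; first by rewrite lee_fin.
exact: area_strip_ge.
Qed.

End PhasePoints.

Lemma clip_contract (R : realType) (j1 j2 x y : R) : j1 <= j2 -> x <= y ->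
  0 <= clip j1 j2 y - clip j1 j2 x <= y - x.
Proof.
by move=> j12; case: (clipP x j12) => -[? ->]; case: (clipP y j12) => -[? ->] ?; lra.
Qed.

(** * The induced planar map *)

Section Reduced.
Variables (R : realType) (n : nat) (i0 : 'I_n) (U : set 'rV[R]_(n + n)).
Variables (Psi : 'rV[R]_(n + n) -> option 'rV[R]_(n + n)) (W : R -> R).
Hypothesis Uo : open U.
Hypothesis good : defined_continuous_volume_conserving U Psi.
Hypothesis energy : forall z w, Psi z = Some w ->
  potential_hamiltonian W w = potential_hamiltonian W z.
Variable phi : 'rV[R]_(1 + 1) -> option 'rV[R]_(1 + 1).
Hypothesis decoupled : forall z w, Psi z = Some w ->
  forall i, phi (phase_proj i z) = Some (phase_proj i w).
Hypothesis cW : continuous W.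
Hypothesis hW : forall q, 0 <= W q <= 8^-1.

Let D q p := U (diag n q p).
(* Where Psi is defined, all components of the image of a diagonal point agree,
   so the choice of i0 is immaterial. *)
Definition Qmap q p := qcoord (odflt 0 (Psi (diag n q p))) i0.
Definition Pmap q p := pcoord (odflt 0 (Psi (diag n q p))) i0.

Lemma n_gt0 : (0 < n)%N.
Proof. exact: leq_ltn_trans (leq0n _) (ltn_ord i0). Qed.

(** The i-th pair of z and the i0-th pair of the diagonal point are both (q, p), and [phi] has only
    one value there. *)
Lemma Psi_coord z w i q p : Psi z = Some w -> D q p -> qcoord z i = q -> pcoord z i = p ->
  qcoord w i = Qmap q p /\ pcoord w i = Pmap q p.
Proof.
move=> zw hD zq zp; have [hdef _ _] := good.
have := hdef _ hD; rewrite /Qmap /Pmap; case e: (Psi (diag n q p)) => [u|] // _ /=.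
have := decoupled zw i; have := decoupled e i0.
rewrite (@phase_proj_eq _ _ i i0 z (diag n q p)) ?qcoord_diag ?pcoord_diag // => -> [].
by move=> /phase_proj_inj[-> ->].
Qed.

Lemma Psi_diag q p : D q p -> Psi (diag n q p) = Some (diag n (Qmap q p) (Pmap q p)).
Proof.
move=> hD; have [hdef _ _] := good.
have := hdef _ hD; case e: (Psi (diag n q p)) => [u|] // _; congr Some.
by apply: phase_ext => i; rewrite ?qcoord_diag ?pcoord_diag;
  have [] := @Psi_coord _ _ i q p e hD; rewrite ?qcoord_diag ?pcoord_diag.
Qed.

(** The energy of a diagonal point is n times that of its planar component, and n > 0 cancels. *)
Lemma energy_diag q p : D q p -> Pmap q p ^+ 2 + 2 * W (Qmap q p) = p ^+ 2 + 2 * W q.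
Proof.
move=> /Psi_diag/energy; rewrite /potential_hamiltonian.
under eq_bigr do rewrite !qcoord_diag !pcoord_diag.
under [RHS]eq_bigr do rewrite !qcoord_diag !pcoord_diag.
rewrite !sumr_const card_ord => /eqP.
by rewrite (eqr_pMn2r n_gt0) => /eqP h; lra.
Qed.

Lemma QP_continuous q p : D q p ->
  {for (q, p), continuous (fun z : R * R => Qmap z.1 z.2)} /\
  {for (q, p), continuous (fun z : R * R => Pmap z.1 z.2)}.
Proof.
move=> hD; have [_ hc _] := good.
have cF : {for (q, p), continuous (fun z : R * R => odflt 0 (Psi (diag n z.1 z.2)))}.
  apply: (@continuous_comp _ _ _ (fun z : R * R => diag n z.1 z.2)
    (fun z => odflt 0 (Psi z))); [exact: diag_continuous|exact: hc].
split.
  apply: (@continuous_comp _ _ _ _ (fun z => qcoord z i0) _ cF).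
  exact: qcoord_continuous.
apply: (@continuous_comp _ _ _ _ (fun z => pcoord z i0) _ cF).
exact: pcoord_continuous.
Qed.

Lemma pair_l_continuous (q p : R) : {for q, continuous (fun x : R => (x, p))}.
Proof.
apply: (@cvg_pair R R R (nbhs q) (nbhs q) (nbhs p) _ _ _ id (cst p)).
  exact: cvg_id.
exact: cvg_cst.
Qed.

Lemma pair_r_continuous (q p : R) : {for p, continuous (fun x : R => (q, x))}.
Proof.
apply: (@cvg_pair R R R (nbhs p) (nbhs q) (nbhs p) _ _ _ (cst q) id).
  exact: cvg_cst.
exact: cvg_id.
Qed.

Lemma Qmap_continuous_l q p : D q p -> {for q, continuous (Qmap^~ p)}.
Proof.
move=> /QP_continuous[h _].
apply: (@continuous_comp R (R * R)%type R (fun x : R => (x, p))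
  (fun z : R * R => Qmap z.1 z.2) q); [exact: pair_l_continuous|exact: h].
Qed.

Lemma Pmap_continuous_l q p : D q p -> {for q, continuous (Pmap^~ p)}.
Proof.
move=> /QP_continuous[_ h].
apply: (@continuous_comp R (R * R)%type R (fun x : R => (x, p))
  (fun z : R * R => Pmap z.1 z.2) q); [exact: pair_l_continuous|exact: h].
Qed.

Lemma Qmap_continuous_r q p : D q p -> {for p, continuous (Qmap q)}.
Proof.
move=> /QP_continuous[h _].
apply: (@continuous_comp R (R * R)%type R (fun x : R => (q, x))
  (fun z : R * R => Qmap z.1 z.2) p); [exact: pair_r_continuous|exact: h].
Qed.

Lemma Pmap_continuous_r q p : D q p -> {for p, continuous (Pmap q)}.
Proof.
move=> /QP_continuous[_ h].
apply: (@continuous_comp R (R * R)%type R (fun x : R => (q, x))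
  (fun z : R * R => Pmap z.1 z.2) p); [exact: pair_r_continuous|exact: h].
Qed.

Lemma within_itv (f : R -> R) (a b : R) :
  (forall q, a <= q <= b -> {for q, continuous f}) -> {within `[a, b], continuous f}.
Proof.
by move=> h; apply: continuous_in_subspaceT => q; rewrite inE /= in_itv /=; exact: h.
Qed.

(** A vanishing P would need 2 W(Q) = p^2 >= 9/16, but 2 W <= 1/4. *)
Lemma Pmap_neq0 q p : D q p -> W q = 0 -> 3 / 4 <= p -> Pmap q p != 0.
Proof.
move=> /energy_diag e Wq p34; apply/eqP => P0; move: e; rewrite P0 Wq.
have := hW (Qmap q p); nra.
Qed.

(** P is continuous in q and has no zero on the interval, so its sign is constant. *)
Lemma Pmap_gt0_itv q1 q2 p : 3 / 4 <= p -> q1 <= q2 ->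
  (forall q, q1 <= q <= q2 -> D q p /\ W q = 0) ->
  (0 < Pmap q1 p) = (0 < Pmap q2 p).
Proof.
move=> p34 q12 hD.
have cP : {within `[q1, q2], continuous (Pmap^~ p)}.
  by apply: within_itv => q /hD[+ _]; exact: Pmap_continuous_l.
have Pn q : q1 <= q <= q2 -> Pmap q p != 0 by move=> /hD[Dq Wq]; exact: Pmap_neq0.
have P1 : Pmap q1 p != 0 by apply: Pn; rewrite lexx.
have P2 : Pmap q2 p != 0 by apply: Pn; rewrite lexx andbT.
have key : ~ (Num.min (Pmap q1 p) (Pmap q2 p) <= 0 <= Num.max (Pmap q1 p) (Pmap q2 p)).
  move=> /(IVT q12 cP)[q]; rewrite in_itv /= => /Pn/eqP.
  by apply.
move: key; rewrite ge_min le_max.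
by case: (ltgtP (Pmap q1 p) 0) P1 => // ? _; case: (ltgtP (Pmap q2 p) 0) P2 => // ? _; case.
Qed.

Lemma near_delta (Pr : R -> Prop) (r : R) : 0 < r -> (\forall p \near (1 : R), Pr p) ->
  exists2 d, 0 < d <= 4^-1 /\ d < r & forall p, 1 - d < p < 1 + d -> Pr p.
Proof.
move=> r0 /nbhs_ballP[e /= e0 he]; exists (Num.min (e / 2) (Num.min (r / 2) 4^-1)).
  split.
    rewrite !lt_min !ge_min lexx !orbT andbT.
    by apply/andP; split; [lra|apply/andP; split; lra].
  by rewrite !gt_min; apply/orP; right; apply/orP; left; lra.
move=> p hp; apply: he; rewrite /ball /=.
have h : Num.min (e / 2) (Num.min (r / 2) 4^-1) <= e / 2 by rewrite ge_min lexx.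
by rewrite ltr_norml; lra.
Qed.

(** * Area comparison over a short interval *)

Section LocalRect.
Variables (c r a b : R).
Hypothesis r0 : 0 < r.
Hypothesis hU : forall z : 'rV[R]_(n + n),
  (forall i, `|qcoord z i - c| < r /\ `|pcoord z i - 1| < r) -> U z.
Hypothesis ab : a < b.
Hypothesis ac : `|a - c| < r.
Hypothesis bc : `|b - c| < r.
Hypothesis W0 : forall q, a <= q <= b -> W q = 0.
Hypothesis Pa : 0 < Pmap a 1.

Let rect d := @phase_rect R n a b (1 - d) (1 + d).

Lemma diag_rect_in q p : a <= q <= b -> `|p - 1| < r -> D q p.
Proof.
move=> qab pr; apply: hU => i; rewrite qcoord_diag pcoord_diag; split=> //.
move: ac bc qab; rewrite !ltr_norml => /andP[? ?] /andP[? ?] /andP[? ?].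
by apply/andP; split; lra.
Qed.

Lemma itv_left : a <= a <= b. Proof. by rewrite lexx ltW. Qed.
Lemma itv_right : a <= b <= b. Proof. by rewrite lexx ltW. Qed.

Lemma near_Pmap_gt0 : \forall p \near (1 : R), 0 < Pmap a p.
Proof.
have D1 : D a 1 by apply: diag_rect_in; rewrite ?itv_left // subrr normr0.
exact: (cvgr_gt (Pmap a 1) (Pmap_continuous_r D1)).
Qed.

Lemma near_Qmap (q e : R) : a <= q <= b -> 0 < e ->
  \forall p \near (1 : R), `|Qmap q p - Qmap q 1| < e.
Proof.
move=> qab e0.
have D1 : D q 1 by apply: diag_rect_in; rewrite // subrr normr0.
have h : Qmap q @ (1 : R) --> Qmap q 1 by exact: Qmap_continuous_r.
by move/cvgrPdist_lt: h => /(_ e e0); apply: filterS => p; rewrite distrC.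
Qed.

Lemma Pmap_gt0_rect (q p d : R) :
  a <= q <= b -> 0 < d <= 4^-1 -> d < r -> 1 - d < p < 1 + d ->
  0 < Pmap a p -> 0 < Pmap q p.
Proof.
move=> /andP[aq qb] /andP[d0 d4] dr /andP[p1 p2].
have pr : `|p - 1| < r by rewrite ltr_norml; lra.
rewrite (@Pmap_gt0_itv a q p) //; first lra.
move=> q' /andP[h1 h2]; have h : a <= q' <= b by rewrite h1 (le_trans h2).
by split; [exact: diag_rect_in|exact: W0].
Qed.

Lemma phase_rect_sub_U d : d < r -> rect d `<=` U.
Proof.
move=> dr z hz; apply: hU => i; have [/andP[q1 q2] /andP[p1 p2]] := hz i.
move: ac bc; rewrite !ltr_norml => /andP[? ?] /andP[? ?].
by split; apply/andP; split; lra.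
Qed.

Lemma volume_image d : 0 < d -> d < r ->
  volume [set w | exists2 z, rect d z & Psi z = Some w] =
  volume (rect d).
Proof.
move=> d0 dr; have [_ _ hv] := good.
by apply: hv; [exact: open_phase_rect|exact: bounded_phase_rect|exact: phase_rect_sub_U].
Qed.

Lemma volume_rect_le d : 0 < d ->
  (volume (rect d) <= ((2 * d * (b - a)) ^+ n)%:E)%E.
Proof.
move=> d0.
rewrite (_ : 2 * d * (b - a) = (b - a) * ((1 + d) - (1 - d))); last by ring.
apply: volume_phase_rect_le => //; [exact: n_gt0|exact: ltW|lra|].
by move=> z hz i; have [/andP[q1 q2] /andP[p1 p2]] := hz i; rewrite !ltW.
Qed.

(** Each pair of w has a preimage in the rectangle: its energy determines p, the intermediate value
    theorem for Q(., p) gives q, and energy conservation with P > 0 fixes the momentum. Both orders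
    of the endpoints are treated, as Q may reverse the interval. *)
Lemma strip_sub_image (x y d e : R) (w : 'rV[R]_(n + n)) :
  ((x = Qmap a 1 /\ y = Qmap b 1) \/ (x = Qmap b 1 /\ y = Qmap a 1)) ->
  0 < d <= 4^-1 -> d < r ->
  (forall p, 1 - d < p < 1 + d ->
    [/\ 0 < Pmap a p, `|Qmap a p - Qmap a 1| < e & `|Qmap b p - Qmap b 1| < e]) ->
  (forall i, strip W (x + e) (y - e) d (qcoord w i, pcoord w i)) ->
  exists2 z, rect d z & Psi z = Some w.
Proof.
move=> hxy hd dr hp hw.
have H i : exists z : R * R, [/\ a < z.1 < b, 1 - d < z.2 < 1 + d,
    Qmap z.1 z.2 = qcoord w i & Pmap z.1 z.2 = pcoord w i].
  have [/= /andP[xq qy] p0 /andP[p1 p2]] := hw i.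
  move: (qcoord w i) (pcoord w i) xq qy p0 p1 p2 => xi et xq qy p0 p1 p2.
  pose p := Num.sqrt (et ^+ 2 + 2 * W xi).
  have p2E : p ^+ 2 = et ^+ 2 + 2 * W xi.
    by rewrite sqr_sqrtr // addr_ge0 ?sqr_ge0 // mulr_ge0 //; have /andP[] := hW xi.
  have pge : 0 <= p by exact: sqrtr_ge0.
  have hp1 : 1 - d < p < 1 + d.
    rewrite -p2E in p1 p2; move: hd => /andP[? ?].
    by rewrite !ltr_pXn2r ?nnegrE // in p1 p2; first (by rewrite p1); lra.
  have [Pap] := hp _ hp1; rewrite !ltr_norml => /andP[A1 A2] /andP[B1 B2].
  have pr : `|p - 1| < r by rewrite ltr_norml; lra.
  have cQ : {within `[a, b], continuous (Qmap^~ p)}.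
    by apply: within_itv => q hq; apply: Qmap_continuous_l; exact: diag_rect_in.
  have [|q] := @IVT _ (Qmap^~ p) a b xi (ltW ab) cQ.
    rewrite ge_min le_max; case: hxy => -[hx hy]; subst x y.
      by apply/andP; split; apply/orP; [left|right]; lra.
    by apply/andP; split; apply/orP; [right|left]; lra.
  rewrite in_itv /= => hq Qq.
  have Dq : D q p by exact: diag_rect_in.
  have Pq := @Pmap_gt0_rect q p d hq hd dr hp1 Pap.
  exists (q, p); split => //=.
    (* The endpoints are excluded because Q moves by less than e there when 1 is replaced by p,
       while the strip has been shrunk by e at both ends. *)
    have qna : q != a.
      apply/eqP => qa; move: Qq A1 A2; rewrite qa.
      by case: hxy => -[hx hy] *; lra.
    have qnb : q != b.
      apply/eqP => qb; move: Qq B1 B2; rewrite qb.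
      by case: hxy => -[hx hy] *; lra.
    by move/andP: hq => [h1 h2]; rewrite lt_def qna h1 /= lt_neqAle qnb h2.
  have := energy_diag Dq; rewrite Qq (W0 hq) p2E mulr0 addr0 => /addIr/eqP.
  by rewrite eqrXn2 // ?ltW // => /eqP.
(* The preimages found in the n planes are assembled into one point z; by decoupling its image is
   w. *)
have [f hf] := choice H.
pose z : 'rV[R]_(n + n) := row_mx (\row_i (f i).1) (\row_i (f i).2).
have qz i : qcoord z i = (f i).1 by rewrite qcoord_row_mx mxE.
have pz i : pcoord z i = (f i).2 by rewrite pcoord_row_mx mxE.
have zA : rect d z by move=> i; rewrite qz pz; have [] := hf i.
exists z => //; have [hdef _ _] := good.
have := hdef _ (phase_rect_sub_U dr zA); case e1: (Psi z) => [w'|] // _; congr Some.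
have K i : qcoord w' i = qcoord w i /\ pcoord w' i = pcoord w i.
  have [h1 h2 <- <-] := hf i.
  apply: (@Psi_coord z w' i _ _ e1) => //.
  apply: diag_rect_in; first by case/andP: h1 => *; rewrite !ltW.
  by case/andP: h2 => *; rewrite ltr_norml; lra.
by apply: phase_ext => i; have [] := K i.
Qed.

Section Weighted.
Variables (j1 j2 k : R).
Hypothesis k0 : 0 <= k.
Hypothesis hk : forall q, j1 <= q <= j2 -> k <= W q.
Hypothesis j12 : j1 <= j2.
(* A lower bound for the travel time to x: slope 1, and 1 + k where W >= k. *)
Let G x := x + k * clip j1 j2 x.

Lemma G_ge (x y : R) : x <= y -> y - x <= G y - G x <= (1 + k) * (y - x).
Proof.
move=> xy; have /andP[h1 h2] := clip_contract j12 xy; rewrite /G.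
have := ler_wpM2l k0 h2; have := mulr_ge0 k0 h1.
by move=> A1 A2; apply/andP; split; lra.
Qed.

(** The product of n shrunk strips lies in the image of the rectangle, which has the volume of the
    rectangle, at most (2 d (b - a))^n. The n-th power and the factor 2 d then cancel. *)
Lemma shrunk_contraction (x y e : R) :
  ((x = Qmap a 1 /\ y = Qmap b 1) \/ (x = Qmap b 1 /\ y = Qmap a 1)) ->
  0 < e -> x + e <= y - e -> G (y - e) - G (x + e) <= b - a.
Proof.
move=> hxy e0 xye.
have [d [hd dr] hp] := near_delta r0 (filterI near_Pmap_gt0
  (filterI (near_Qmap itv_left e0) (near_Qmap itv_right e0))).
have d0 : 0 < d by case/andP: hd.
have h : (((2 * d * (G (y - e) - G (x + e))) ^+ n)%:E <= ((2 * d * (b - a)) ^+ n)%:E)%E.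
  apply: le_trans (volume_rect_le d0); rewrite -volume_image //.
  apply: volume_strip_ge => // w hw; apply: (strip_sub_image hxy hd dr _ hw) => p /hp[? [? ?]].
  by split.
have G0 : 0 <= G (y - e) - G (x + e) by have := G_ge xye; lra.
have B0 : 0 <= b - a by rewrite subr_ge0 ltW.
have d2 : 0 < 2 * d by rewrite mulr_gt0.
move: h; rewrite lee_fin ler_pXn2r ?n_gt0 // ?nnegrE ?(mulr_ge0 (ltW d2)) //.
by rewrite ler_pM2l.
Qed.

(** Let the shrinking e tend to 0 in [shrunk_contraction], once for each order of the endpoints. *)
Lemma local_contraction : `|G (Qmap b 1) - G (Qmap a 1)| <= b - a.
Proof.
have key (x y : R) : ((x = Qmap a 1 /\ y = Qmap b 1) \/ (x = Qmap b 1 /\ y = Qmap a 1)) ->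
    x <= y -> G y - G x <= b - a.
  move=> hxy xy; apply/ler_addgt0Pr => /= e e0.
  (* Since [G] is (1 + k)-Lipschitz, shrinking by e' at both ends costs at most 2 (1 + k) e'. If
     nothing is left after shrinking, this alone bounds the difference. *)
  have [e' e'0 ee] : exists2 e' : R, 0 < e' & 2 * ((1 + k) * e') = e.
    have k1 : 0 < 1 + k by rewrite ltr_wpDr.
    exists (e / (2 * (1 + k))); first by rewrite divr_gt0 // mulr_gt0.
    by field; rewrite gt_eqF.
  have [xye|yxe] := lerP (x + e') (y - e').
    have := shrunk_contraction hxy e'0 xye.
    have /G_ge/andP[_] : x <= x + e' by lra.
    have /G_ge/andP[_] : y - e' <= y by lra.
    rewrite (_ : y - (y - e') = e') 1?(_ : x + e' - x = e'); [lra|ring|ring].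
  have := G_ge xy => /andP[_ h].
  have k1 : 0 <= 1 + k by exact: addr_ge0.
  have xy2 : y - x <= 2 * e' by lra.
  have := ler_wpM2l k1 xy2.
  move: ab; lra.
rewrite ler_norml; have [h|h] := lerP (Qmap a 1) (Qmap b 1).
  have := key _ _ (or_introl (conj erefl erefl)) h.
  have := G_ge h; move: ab; lra.
have := key _ _ (or_intror (conj erefl erefl)) (ltW h).
have := G_ge (ltW h); move: ab; lra.
Qed.

End Weighted.

(** The image of the rectangle lies between the minimum and the maximum of Q(., 1), up to e, with
    the same momenta; volume conservation forces max - min >= b - a. As Q is 1-Lipschitz, the
    extrema must then be attained at a and b. *)
Lemma free_local_isometry : (forall q, W q = 0) ->
  (forall s t, a <= s <= b -> a <= t <= b -> `|Qmap s 1 - Qmap t 1| <= `|s - t|) ->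
  b - a <= `|Qmap b 1 - Qmap a 1|.
Proof.
move=> W00 lip.
have D1 q : a <= q <= b -> D q 1 by move=> h; apply: diag_rect_in => //; rewrite subrr normr0.
have cQ : {within `[a, b], continuous (Qmap^~ 1)}.
  by apply: within_itv => q hq; apply: Qmap_continuous_l; exact: D1.
have [s sab hs] := EVT_max (ltW ab) cQ.
have [t tab ht] := EVT_min (ltW ab) cQ.
have hs' q : a <= q <= b -> Qmap q 1 <= Qmap s 1 by move=> h; apply: hs; rewrite in_itv.
have ht' q : a <= q <= b -> Qmap t 1 <= Qmap q 1 by move=> h; apply: ht; rewrite in_itv.
rewrite !in_itv /= in sab tab.
suff M : b - a <= Qmap s 1 - Qmap t 1.
  have := lip _ _ sab tab; move: sab tab => /andP[s1 s2] /andP[t1 t2].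
  have := ler_norm (Qmap s 1 - Qmap t 1).
  have [st|ts] := lerP s t => h1 h2.
    have [es et] : s = a /\ t = b.
      by split; lra.
    by rewrite -es -et distrC; lra.
  have [es et] : s = b /\ t = a.
    by split; lra.
  by rewrite -es -et; lra.
have ts : Qmap t 1 <= Qmap s 1 by exact: hs'.
apply/ler_addgt0Pr => e' e'0; pose e := e' / 2.
have e0 : 0 < e by rewrite /e; lra.
have ee : e' = 2 * e by rewrite /e; lra.
(* Compactness of [a, b] makes the choice of p near 1 uniform in q. *)
have hcov : \forall p \near (1 : R),
    `[a, b]%classic `<=` (fun q => Qmap t 1 - e < Qmap q p < Qmap s 1 + e).
  have /compact_near_coveringP cov := @segment_compact R a b.
  apply: (cov _ (nbhs (1 : R)) (fun p q => Qmap t 1 - e < Qmap q p < Qmap s 1 + e)) => q /=.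
  rewrite in_itv /= => hq.
  have [cq _] := QP_continuous (D1 _ hq).
  have A1 := hs' _ hq; have A2 := ht' _ hq.
  near=> z.
  have : `|Qmap q 1 - Qmap z.1 z.2| < e.
    by near: z; move/cvgrPdist_lt: cq => /(_ e e0).
  by rewrite ltr_norml => /andP[? ?]; apply/andP; split; lra.
have [d [hd dr] hp] := near_delta r0 (filterI near_Pmap_gt0 hcov).
have d0 : 0 < d by case/andP: hd.
(* Without potential the rectangle contains the product of n strips over [a, b], so the strip bound
   with k = 0 applies to it. *)
have h1 : (((2 * d * (b - a)) ^+ n)%:E <= volume (rect d))%E.
  have := @volume_strip_ge R n W a b d 0 0 0 (rect d) cW hW hd (lexx _).
  rewrite !mul0r !addr0; apply => //; first by move=> q _; have /andP[] := hW q.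
    exact: ltW.
  move=> z hz i; have [/= -> p0 /andP[p1 p2]] := hz i; split=> //.
  rewrite W00 mulr0 addr0 in p1 p2; move: hd => /andP[? ?].
  by rewrite !ltr_pXn2r ?nnegrE // in p1 p2; first (by rewrite p1); lra.
have h2 : (volume (rect d) <=
    ((2 * d * (Qmap s 1 - Qmap t 1 + e')) ^+ n)%:E)%E.
  rewrite -volume_image //.
  rewrite (_ : 2 * d * _ =
    ((Qmap s 1 + e) - (Qmap t 1 - e)) * ((1 + d) - (1 - d))); last first.
    by rewrite ee; ring.
  apply: volume_phase_rect_le => //; [exact: n_gt0|lra|lra|].
  move=> w [z hz zw] i; have [q1 p1] := hz i.
  have qab : a <= qcoord z i <= b by case/andP: q1 => *; rewrite !ltW.
  have [Pa1 /(_ (qcoord z i))] := hp _ p1; rewrite /= in_itv /= qab => /(_ isT) Qz.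
  have Dz : D (qcoord z i) (pcoord z i).
    by apply: diag_rect_in => //; case/andP: p1 => *; rewrite ltr_norml; lra.
  have [-> ->] := Psi_coord zw Dz erefl erefl.
  split; first by case/andP: Qz => *; rewrite !ltW.
  (* With W = 0, energy conservation and positivity give P = p. *)
  have Pz := Pmap_gt0_rect qab hd dr p1 Pa1.
  have := energy_diag Dz; rewrite !W00 => /addIr/eqP; rewrite eqrXn2 ?(ltW Pz) //; last first.
    by case/andP: p1 => *; move: hd => /andP[? ?]; lra.
  by move=> /eqP ->; case/andP: p1 => *; rewrite !ltW.
have := le_trans h1 h2.
have B0 : 0 <= b - a by rewrite subr_ge0 ltW.
have S0 : 0 <= Qmap s 1 - Qmap t 1 + e' by lra.
have d2 : 0 < 2 * d by rewrite mulr_gt0.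
rewrite lee_fin ler_pXn2r ?n_gt0 // ?nnegrE ?(mulr_ge0 (ltW d2)) //.
by rewrite ler_pM2l.
Unshelve. all: by end_near. Qed.

End LocalRect.
End Reduced.

(** * From local to global estimates along p = 1 *)

(** Let s be the supremum of the t in [a, b] with f t <= f a. Comparison on the left of s shows that
    s belongs to this set; if s < b, comparison on the right extends the set beyond s. *)
Lemma locally_nincr (R : realType) (f : R -> R) (a b : R) : a <= b ->
  (forall c, a <= c <= b -> exists2 r, 0 < r & forall t, a <= t <= b -> `|t - c| < r ->
     (c <= t -> f t <= f c) /\ (t <= c -> f c <= f t)) ->
  f b <= f a.
Proof.
move=> ab loc.
pose E := [set t | a <= t <= b /\ f t <= f a].
have Ea : E a by split; rewrite ?lexx ?ab.
have Eub : ubound E b by move=> t [/andP[]].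
have hs : has_sup E by split; [exists a|exists b].
pose s := sup E.
have as_ : a <= s by apply: ub_le_sup => //; exists b.
have sb : s <= b by apply: ge_sup => //; exists a.
have sab : a <= s <= b by rewrite as_ sb.
have [r r0 hr] := loc s sab.
have Es : f s <= f a.
  have [t Et ts] := sup_adherent r0 hs.
  have tles : t <= s by apply: ub_le_sup => //; exists b.
  have [tab fta] := Et.
  have [|_ /(_ tles)/le_trans] := hr t tab; last exact.
  by rewrite ltr_norml; rewrite -/s in ts; lra.
have [|bs] := lerP b s.
  by move=> bs; have -> : b = s by apply/eqP; rewrite eq_le bs sb.
pose t := Num.min b (s + r / 2).
have st : s < t by rewrite lt_min bs /= ltrDl divr_gt0.
have tb : t <= b by rewrite ge_min lexx.
have ts : t <= s + r / 2 by rewrite ge_min lexx orbT.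
have tab : a <= t <= b by rewrite tb (le_trans as_ (ltW st)).
have [|/(_ (ltW st)) fts _] := hr t tab; first by rewrite ltr_norml; lra.
have : t <= s by apply: ub_le_sup; [exists b|split=> //; exact: le_trans Es].
by rewrite leNgt st.
Qed.

Section Global.
Variables (R : realType) (n : nat) (i0 : 'I_n) (U : set 'rV[R]_(n + n)).
Variables (Psi : 'rV[R]_(n + n) -> option 'rV[R]_(n + n)) (W : R -> R).
Hypothesis Uo : open U.
Hypothesis good : defined_continuous_volume_conserving U Psi.
Hypothesis energy : forall z w, Psi z = Some w ->
  potential_hamiltonian W w = potential_hamiltonian W z.
Variable phi : 'rV[R]_(1 + 1) -> option 'rV[R]_(1 + 1).
Hypothesis decoupled : forall z w, Psi z = Some w ->
  forall i, phi (phase_proj i z) = Some (phase_proj i w).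
Hypothesis cW : continuous W.
Hypothesis hW : forall q, 0 <= W q <= 8^-1.
Variables (al be : R).
Hypothesis hUd : forall q, U (diag n q 1).
Hypothesis W0 : forall q, al <= q <= be -> W q = 0.
Hypothesis Pal : 0 < Pmap i0 Psi al 1.

Let Q q := Qmap i0 Psi q 1.

Lemma Pmap_gt0 q : al <= q <= be -> 0 < Pmap i0 Psi q 1.
Proof.
move=> /andP[h1 h2].
rewrite -(@Pmap_gt0_itv _ _ i0 U Psi W good energy phi decoupled hW al q 1) //; first lra.
move=> q' /andP[h3 h4]; split; first exact: hUd.
by apply: W0; rewrite h3 (le_trans h4).
Qed.

Lemma local_ball c : exists2 r, 0 < r & forall z : 'rV[R]_(n + n),
  (forall i, `|qcoord z i - c| < r /\ `|pcoord z i - 1| < r) -> U z.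
Proof.
have : nbhs (diag n c 1) U by apply: open_nbhs_nbhs; split => //; exact: hUd.
move=> /nbhs_phase[r r0 h]; exists r => // z hz; apply: h => i.
by rewrite qcoord_diag pcoord_diag.
Qed.

Section Weighted.
Variables (j1 j2 k : R).
Hypothesis k0 : 0 <= k.
Hypothesis hk : forall q, j1 <= q <= j2 -> k <= W q.
Hypothesis j12 : j1 <= j2.
Let G x := x + k * clip j1 j2 x.

Lemma nearby_contraction c : exists2 r, 0 < r &
  forall s t, al <= s <= be -> al <= t <= be ->
  s < t -> `|s - c| < r -> `|t - c| < r -> `|G (Q t) - G (Q s)| <= t - s.
Proof.
have [r r0 hr] := local_ball c; exists r => // s t hs ht st sc tc.
apply: (@local_contraction _ _ i0 U Psi W good energy phi decoupled cW hW
  c r s t r0 hr st sc tc) => //.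
  move=> q /andP[h1 h2]; apply: W0; move: hs ht => /andP[? ?] /andP[? ?].
  by apply/andP; split; lra.
exact: Pmap_gt0.
Qed.

(** The local bound says that both G(Q t) - t and - G(Q t) - t are locally nonincreasing, hence
    nonincreasing; [sg] selects the sign. *)
Lemma contraction s t : al <= s -> s <= t -> t <= be -> `|G (Q t) - G (Q s)| <= t - s.
Proof.
move=> als st tbe.
have H (sg : bool) : (-1) ^+ sg * G (Q t) - t <= (-1) ^+ sg * G (Q s) - s.
  apply: (@locally_nincr _ (fun t => (-1) ^+ sg * G (Q t) - t) s t) => // c /andP[sc ct].
  have [r r0 hr] := nearby_contraction c; exists r => // u /andP[su ut] uc.
  have hc : al <= c <= be by rewrite (le_trans als sc) (le_trans ct tbe).
  have hu : al <= u <= be by rewrite (le_trans als su) (le_trans ut tbe).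
  have cc : `|c - c| < r by rewrite subrr normr0.
  have [uc'|cu|->] := ltgtP u c; last by split.
    have := hr _ _ hu hc uc' uc cc; rewrite ler_norml => /andP[h1 h2].
    by split=> // _; case: sg; rewrite ?expr1 ?expr0; lra.
  have := hr _ _ hc hu cu cc uc; rewrite ler_norml => /andP[h1 h2].
  by split=> // _; case: sg; rewrite ?expr1 ?expr0; lra.
have := H false; have := H true; rewrite expr0 expr1 ler_norml; lra.
Qed.

End Weighted.

(** For k = 0 the weighted length [G] is the identity. *)
Lemma free_lipschitz s t : al <= s -> s <= t -> t <= be -> `|Q t - Q s| <= t - s.
Proof.
move=> h1 h2 h3.
have := @contraction 0 0 0 (lexx _) (fun q _ => proj1 (andP (hW q))) (lexx _) s t h1 h2 h3.
by rewrite !mul0r !addr0.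
Qed.

(** Nearby pairs satisfy |Q t - Q s| = t - s. If the positive sign never occurred, Q t + t would be
    locally constant, and Q be + be <= Q al + al would contradict the two strict inequalities. *)
Lemma free_isometry_pair : (forall q, W q = 0) -> al < be -> Q al < Q be ->
  exists s t, [/\ al <= s, s < t, t <= be & Q t - Q s = t - s].
Proof.
move=> W00 alb Qab; apply: contrapT => nex.
suff : Q be + be <= Q al + al by lra.
apply: (@locally_nincr _ (fun t => Q t + t)); first exact: ltW.
move=> c hc; have [r r0 hr] := local_ball c; exists r => // u hu uc.
have cc : `|c - c| < r by rewrite subrr normr0.
have key s t : al <= s <= be -> al <= t <= be -> s < t -> `|s - c| < r -> `|t - c| < r ->
    Q t - Q s = s - t.
  move=> hs ht st sc tc.
  have hst q : s <= q <= t -> al <= q <= be.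
    by move: hs ht => /andP[? ?] /andP[? ?] /andP[? ?]; apply/andP; split; lra.
  have lip x y : s <= x <= t -> s <= y <= t -> `|Q x - Q y| <= `|x - y|.
    move=> /hst/andP[? ?] /hst/andP[? ?].
    have [xy|yx] := leP x y.
      by rewrite distrC [leRHS]distrC (ger0_norm (x := y - x)) ?subr_ge0 // free_lipschitz.
    by rewrite (ger0_norm (x := x - y)) ?subr_ge0 ?(ltW yx) // free_lipschitz // ltW.
  have := @free_local_isometry _ _ i0 U Psi W good energy phi decoupled cW hW
    c r s t r0 hr st sc tc (fun q h => W0 (hst q h)) (Pmap_gt0 hs) W00 lip.
  have := lip t s; rewrite !lexx (ltW st) => /(_ isT isT).
  rewrite (gtr0_norm (x := t - s)) ?subr_gt0 // -/(Q t) -/(Q s) => h1 h2.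
  have h : `|Q t - Q s| = t - s by lra.
  have [q0|q0] := lerP 0 (Q t - Q s).
    case: nex; exists s, t; move: hs ht => /andP[? ?] /andP[? ?]; split=> //.
    by rewrite -h ger0_norm.
  by rewrite ltr0_norm // in h; lra.
have [uc'|cu|->] := ltgtP u c; last by split.
  by split=> // _; have := key _ _ hu hc uc' uc cc; lra.
by split=> // _; have := key _ _ hc hu cu cc uc; lra.
Qed.

(** Q is 1-Lipschitz, so Q t - t is nonincreasing; being positive at [be], it is positive at every
    earlier point. *)
Lemma free_drift : (forall q, W q = 0) -> al < be -> Q al < Q be -> be < Q be ->
  exists s t, [/\ s < t, Q t - Q s = t - s, t < Q t & 0 < Pmap i0 Psi s 1].
Proof.
move=> W00 alb Qab Qbe.
have [s [t [als st tbe Qst]]] := free_isometry_pair W00 alb Qab.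
exists s, t; split=> //.
  have := free_lipschitz (le_trans als (ltW st)) tbe (lexx _).
  by rewrite ler_norml; lra.
by apply: Pmap_gt0; rewrite als (le_trans (ltW st)).
Qed.

End Global.

(** * The free particle *)

Section Assembly.
Variables (R : realType) (n : nat).

Definition separable_term (V : R -> R) (j : 'I_(n + n)) : R -> R :=
  match fintype.split j with inl _ => V | inr _ => fun x => x ^+ 2 / 2 end.

Lemma potential_coord_sum (V : R -> R) :
  potential_hamiltonian (n := n) V = coord_sum (separable_term V).
Proof.
apply/funext => z; rewrite /potential_hamiltonian /coord_sum big_split_ord /= -big_split /=.
apply: eq_bigr => i _; rewrite /separable_term.
by rewrite -/(unsplit (inl i)) -/(unsplit (inr i)) !unsplitK addrC.
Qed.

Lemma Cinf_separable_term (V : R -> R) j : Cinf V -> Cinf (separable_term V j).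
Proof.
move=> hV; rewrite /separable_term; case: fintype.split => // _.
have -> : (fun x : R => x ^+ 2 / 2) = (id * id) * cst 2^-1 by apply/funext => x; rewrite expr2.
by apply: CinfM; [apply: CinfM; exact: Cinf_id|exact: Cinf_cst].
Qed.

Lemma smooth_potential (V : R -> R) : Cinf V -> smooth (potential_hamiltonian (n := n) V).
Proof.
move=> hV; rewrite potential_coord_sum; apply: smooth_coord_sum => j.
exact: Cinf_separable_term.
Qed.

Lemma free_potential : @free_hamiltonian R n = potential_hamiltonian (fun=> 0).
Proof. by apply/funext => z; apply: eq_bigr => i _; rewrite addr0. Qed.

Lemma derive_free (z : 'rV[R]_(n + n)) (i : 'I_n) :
  partial (rshift n i) (@free_hamiltonian R n) z = pcoord z i /\
  partial (lshift n i) (@free_hamiltonian R n) z = 0.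
Proof.
rewrite free_potential potential_coord_sum /partial.
have hC j : Cinf (separable_term (fun=> 0) j).
  by apply: Cinf_separable_term; exact: Cinf_cst.
split; rewrite (@derive_val _ _ _ _ _ _ _ (is_derive_coord_sum _ z hC)) /separable_term.
  rewrite -/(unsplit (inr i)) unsplitK derive1E.
  have -> : (fun x : R => x ^+ 2 / 2) = (id * id) * cst 2^-1.
    by apply/funext => x; rewrite expr2.
  rewrite derive_val /GRing.scale /= !mulr1 mulr0 add0r.
  rewrite /pcoord; move: (z 0 _) => x; rewrite /cst; lra.
by rewrite -/(unsplit (inl i)) unsplitK derive1_cst.
Qed.

(** The momentum has derivative 0 in t, and hence so has q - t p. *)
Lemma free_flow (S : R -> 'rV[R]_(n + n) -> 'rV[R]_(n + n)) t z i :
  is_flow (@free_hamiltonian R n) S ->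
  qcoord (S t z) i = qcoord z i + t * pcoord z i /\ pcoord (S t z) i = pcoord z i.
Proof.
move=> [S0 hS].
have hp s : pcoord (S s z) i = pcoord z i.
  rewrite -[in RHS](S0 z).
  apply: (@is_derive_0_is_cst _ (fun s => pcoord (S s z) i)) => u.
  by have [_] := hS z u i; have [_ ->] := derive_free (S u z) i; rewrite oppr0.
split=> //.
suff : (qcoord (S t z) i - t * pcoord z i) = (qcoord (S 0 z) i - 0 * pcoord z i).
  by rewrite S0; lra.
apply: (@is_derive_0_is_cst _ (fun s => qcoord (S s z) i - s * pcoord z i)) => u.
have [dq _] := hS z u i; have [e _] := derive_free (S u z) i; rewrite e hp in dq.
have dl : is_derive u (1 : R) (fun s : R => s * pcoord z i) (pcoord z i).
  have := @is_deriveM _ _ id (cst (pcoord z i)) u 1 1 0 _ _.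
  by rewrite /GRing.scale /= mulr0 add0r mulr1; apply.
by have := is_deriveB dq dl; rewrite subrr.
Qed.

Lemma le_mx_norm (z : 'rV[R]_(n + n)) j : `|z 0 j| <= `|z|.
Proof.
rewrite [leRHS]/Num.norm /= mx_normrE.
exact: (le_bigmax _ (fun ij : 'I_1 * 'I_(n + n) => `|z ij.1 ij.2|) (0, j)).
Qed.

(** The o(dt) error is below dt/2 for small dt, and the norm bounds each coordinate. *)
Lemma consistent_free (Phi : integrator R n)
    (S : R -> 'rV[R]_(n + n) -> 'rV[R]_(n + n)) (q : R) (i0 : 'I_n) :
  is_flow (@free_hamiltonian R n) S ->
  consistent_at Phi (@free_hamiltonian R n) S (diag n q 1) ->
  \forall dt \near 0^'+,
    `|Qmap i0 (fun z => Phi (@free_hamiltonian R n) z dt) q 1 - (q + dt)| < dt / 2 /\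
    `|Pmap i0 (fun z => Phi (@free_hamiltonian R n) z dt) q 1 - 1| < dt / 2.
Proof.
move=> hS [_ /cvgrPdist_lt /(_ 2^-1)]; rewrite invr_gt0 => /(_ (ltr0n _ 2)).
move=> h; near=> dt.
have dt0 : 0 < dt by near: dt; exact: nbhs_right_gt.
have : `|0 - `|S dt (diag n q 1) -
    odflt 0 (Phi (@free_hamiltonian R n) (diag n q 1) dt)| / dt| < 2^-1.
  by near: dt.
set w := odflt 0 _.
rewrite sub0r normrN normrM normr_id (gtr0_norm (x := dt^-1)) ?invr_gt0 //.
rewrite ltr_pdivrMr // => hd.
have [fq fp] := free_flow dt (diag n q 1) i0 hS.
rewrite qcoord_diag pcoord_diag mulr1 in fq; rewrite pcoord_diag in fp.
have {}hd : `|S dt (diag n q 1) - w| < dt / 2 by lra.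
have h1 := le_lt_trans (le_mx_norm _ (lshift n i0)) hd.
have h2 := le_lt_trans (le_mx_norm _ (rshift n i0)) hd.
rewrite !mxE -!/(qcoord _ _) -!/(pcoord _ _) ?fq ?fp in h1 h2.
by split; rewrite distrC.
Unshelve. all: by end_near. Qed.

(** By induction on the list: for a further point e, keep the outer quarter of the interval on the
    side of the midpoint away from e. *)
Lemma avoid_finite (s : seq R) (x y : R) : x < y ->
  exists i1 i2, [/\ x < i1, i1 < i2, i2 < y & forall e, e \in s -> (e < i1) || (i2 < e)].
Proof.
elim: s x y => [|e s IH] x y xy.
  by exists ((2 * x + y) / 3), ((x + 2 * y) / 3); split=> //; lra.
have [i1 [i2 [h1 h2 h3 h4]]] := IH x y xy.
have [em|me] := lerP e ((i1 + i2) / 2).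
  exists ((i1 + 3 * i2) / 4), i2; split; try lra.
  move=> f; rewrite inE => /orP[/eqP ->|/h4/orP[h|->]]; rewrite ?orbT //; apply/orP; left; lra.
exists i1, ((3 * i1 + i2) / 4); split; try lra.
move=> f; rewrite inE => /orP[/eqP ->|/h4/orP[->|h]] //; apply/orP; right; lra.
Qed.

Lemma near_potential (W : R -> R) (r : 'rV[R]_(n + n)) (i1 i2 : R) :
  (forall q, ~~ (i1 < q < i2) -> W q = 0) ->
  (forall i, (qcoord r i < i1) || (i2 < qcoord r i)) ->
  \forall z \near r, potential_hamiltonian W z = @free_hamiltonian R n z.
Proof.
move=> W0 hr.
have h i : \forall z \near r, W (qcoord z i) = 0.
  have cq : (fun z : 'rV[R]_(n + n) => qcoord z i) @ r --> qcoord r i.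
    exact: qcoord_continuous.
  have /orP[h|h] := hr i.
    move/(cvgr_lt (qcoord r i)): cq => /(_ _ h); apply: filterS => z hz.
    by apply: W0; rewrite negb_and -leNgt (ltW hz).
  move/(cvgr_gt (qcoord r i)): cq => /(_ _ h); apply: filterS => z hz.
  by apply: W0; rewrite negb_and -!leNgt (ltW hz) orbT.
have := @filter_forall _ _ (fun i z => W (qcoord z i) = 0) (nbhs r) (nbhs_filter r) h.
by apply: filterS => z hz; apply: eq_bigr => i _; rewrite hz addr0.
Qed.

End Assembly.

(** * The obstruction *)

Lemma decoupling_potential (R : realType) (n : nat) (Phi : integrator R n)
    (W : R -> R) (dt : R) :
  respects_decoupling Phi -> Cinf W -> 0 <= dt ->
  exists phi : 'rV[R]_(1 + 1) -> option 'rV[R]_(1 + 1),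
    forall z w, Phi (potential_hamiltonian W) z dt = Some w ->
      forall i, phi (phase_proj i z) = Some (phase_proj i w).
Proof.
move=> h4 hW dt0.
pose h (y : 'rV[R]_(1 + 1)) := pcoord y 0 ^+ 2 / 2 + W (qcoord y 0).
have [|phi hphi] := h4 (potential_hamiltonian W) h (smooth_potential hW).
  move=> z; apply: eq_bigr => i _.
  by rewrite /h /phase_proj pcoord_row_mx qcoord_row_mx !mxE.
by exists (fun y => phi h y dt) => z w zw i; exact: hphi zw i.
Qed.

(** By [ea] and [eb] the images over a and b are those of the free integrator. As [j1, j2] lies in
    [Q a, Q b], the weighted distance between them is at least b - a + k (j2 - j1), contradicting
    [contraction]. *)
Lemma bump_obstruction (R : realType) (n : nat) (i0 : 'I_n) (Phi : integrator R n)
    (U : set 'rV[R]_(n + n)) (dt : R) (W : R -> R) (a b j1 j2 k : R)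
    (Q := fun q => Qmap i0 (fun z => Phi (@free_hamiltonian R n) z dt) q 1) :
  open U -> (forall q, U (diag n q 1)) -> 0 <= dt ->
  conserves_energy Phi -> respects_decoupling Phi ->
  Cinf W -> (forall q, 0 <= W q <= 8^-1) -> (forall q, a <= q <= b -> W q = 0) ->
  0 < k -> (forall q, j1 <= q <= j2 -> k <= W q) -> j1 < j2 ->
  a <= b -> Q b - Q a = b - a -> Q a <= j1 -> j2 <= Q b ->
  0 < Pmap i0 (fun z => Phi (@free_hamiltonian R n) z dt) a 1 ->
  Phi (@free_hamiltonian R n) (diag n a 1) dt =
    Phi (potential_hamiltonian W) (diag n a 1) dt ->
  Phi (@free_hamiltonian R n) (diag n b 1) dt =
    Phi (potential_hamiltonian W) (diag n b 1) dt ->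
  ~ defined_continuous_volume_conserving U (fun z => Phi (potential_hamiltonian W) z dt).
Proof.
move=> Uo hU dt0 h3 h4 hC hW W0 k0 hk j12 ab Qab Qa Qb Pa ea eb good.
have [phi hphi] := decoupling_potential h4 hC dt0.
have en z w : Phi (potential_hamiltonian W) z dt = Some w ->
    potential_hamiltonian W w = potential_hamiltonian W z.
  exact: h3 (smooth_potential hC) dt0.
have Pa' : 0 < Pmap i0 (fun z => Phi (potential_hamiltonian W) z dt) a 1.
  by rewrite /Pmap -ea.
have := @contraction _ _ i0 U _ W Uo good en phi hphi (Cinf_continuous hC) hW a b hU W0 Pa'
  j1 j2 k (ltW k0) hk (ltW j12) a b (lexx _) ab (lexx _).
have -> : Qmap i0 (fun z => Phi (potential_hamiltonian W) z dt) a 1 = Q a.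
  by rewrite /Q /Qmap ea.
have -> : Qmap i0 (fun z => Phi (potential_hamiltonian W) z dt) b 1 = Q b.
  by rewrite /Q /Qmap eb.
have -> : clip j1 j2 (Q a) = j1 by case: (clipP (Q a) (ltW j12)) => -[? ->]; lra.
have -> : clip j1 j2 (Q b) = j2 by case: (clipP (Q b) (ltW j12)) => -[? ->]; lra.
move=> /(le_trans (ler_norm _)).
have : 0 < k * (j2 - j1) by rewrite mulr_gt0 // subr_gt0.
lra.
Qed.

Theorem theorem3 (R : realType) (n : nat) (Phi : integrator R n)
    (U : set 'rV[R]_(n + n))
    (S : R -> 'rV[R]_(n + n) -> 'rV[R]_(n + n))
    (hn : (2 <= n)%N)
    (hUopen : open U)
    (hU : forall x : R, U (row_mx (const_mx x) (const_mx 1)))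
    (hS : is_flow (@free_hamiltonian R n) S)
    (h1 : forall z, consistent_at Phi (@free_hamiltonian R n) S z)
    (h2 : computationally_reasonable Phi)
    (h3 : conserves_energy Phi)
    (h4 : respects_decoupling Phi)
    (h5 : \forall dt \near (0 : R)^'+,
        defined_continuous_volume_conserving U
          (fun z => Phi (@free_hamiltonian R n) z dt)) :
  \forall dt \near (0 : R)^'+,
    exists V : R -> R,
      [/\ smooth_compact_support V,
          ~ defined_continuous_volume_conserving U
              (fun z => Phi (potential_hamiltonian V) z dt)
        & forall lam : R, 0 < lam < 1 ->
            ~ defined_continuous_volume_conserving U
                (fun z => Phi (potential_hamiltonian (fun x => lam * V x)) z dt)].
Proof.
have n0 : (0 < n)%N by exact: leq_trans hn.
pose i0 := Ordinal n0.
have c0 := consistent_free i0 hS (h1 (diag n 0 1)).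
have cm := consistent_free i0 hS (h1 (diag n (-1) 1)).
near=> dt.
have dt0 : 0 < dt by near: dt; exact: nbhs_right_gt.
(* With errors below dt/2, this bound yields Q(-1) < Q(0) and a positive momentum over -1. *)
have dt1 : dt < 2^-1 by near: dt; apply: nbhs_right_lt; rewrite invr_gt0.
have good : defined_continuous_volume_conserving U
  (fun z => Phi (@free_hamiltonian R n) z dt) by near: dt.
have H0 : `|Qmap i0 (fun z => Phi (@free_hamiltonian R n) z dt) 0 1 - (0 + dt)| < dt / 2 /\
    `|Pmap i0 (fun z => Phi (@free_hamiltonian R n) z dt) 0 1 - 1| < dt / 2 by near: dt.
have Hm : `|Qmap i0 (fun z => Phi (@free_hamiltonian R n) z dt) (-1) 1 - (-1 + dt)| < dt / 2 /\
    `|Pmap i0 (fun z => Phi (@free_hamiltonian R n) z dt) (-1) 1 - 1| < dt / 2 by near: dt.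
pose Psi z := Phi (@free_hamiltonian R n) z dt.
pose Q q := Qmap i0 Psi q 1.
have [Q0 P0] : `|Q 0 - (0 + dt)| < dt / 2 /\ `|Pmap i0 Psi 0 1 - 1| < dt / 2 := H0.
have [Qm Pm] : `|Q (-1) - (-1 + dt)| < dt / 2 /\ `|Pmap i0 Psi (-1) 1 - 1| < dt / 2 := Hm.
move: Q0 Qm Pm {P0}; rewrite !ltr_norml => Q0 Qm Pm.
have Pm0 : 0 < Pmap i0 Psi (-1) 1 by lra.
have m10 : (-1 : R) < 0 by lra.
have QmQ0 : Q (-1) < Q 0 by lra.
have Q0pos : 0 < Q 0 by lra.
have C0 : Cinf (fun _ : R => 0 : R) := Cinf_cst 0.
have F0 := @free_potential R n.
have [phi hphi] := decoupling_potential h4 C0 (ltW dt0).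
rewrite -F0 in hphi.
have en z w : Psi z = Some w ->
    potential_hamiltonian (fun=> 0) w = potential_hamiltonian (fun=> 0) z.
  by rewrite -F0; apply: h3 (ltW dt0); rewrite F0; exact: smooth_potential.
have c00 : continuous (fun _ : R => 0 : R) by exact: Cinf_continuous.
have b00 : forall q : R, ((0 : R) <= (0 : R)) && ((0 : R) <= 8^-1).
  by move=> _; rewrite lexx invr_ge0 ler0n.
have [a [b [ab Qab Qb Pa]]] := @free_drift _ _ i0 U Psi (fun=> 0) hUopen good en phi hphi
  c00 b00 (-1) 0 hU (fun _ _ => erefl) Pm0 (fun _ => erefl) m10 QmQ0 Q0pos.
clear b00 c00.
have {}Qab : Q b - Q a = b - a := Qab.
have {}Qb : b < Q b := Qb.
have Qa : Q a < Q b by lra.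
have sm : smooth (@free_hamiltonian R n) by rewrite F0; exact: smooth_potential.
have [m1 [r1 [al1 hr1]]] := h2 _ (diag n a 1) dt sm (ltW dt0).
have [m2 [r2 [al2 hr2]]] := h2 _ (diag n b 1) dt sm (ltW dt0).
(* All positions occurring in the finitely many points that determine the images over a and b. *)
pose E := [seq qcoord (r1 j) i | j <- enum 'I_m1, i <- enum 'I_n] ++
          [seq qcoord (r2 j) i | j <- enum 'I_m2, i <- enum 'I_n].
(* To the right of b the bump leaves [a, b] free of potential; between Q a and Q b it delays the
   motion from one image to the other. *)
have [|i1 [i2 [hi1 i12 hi2 hE]]] := @avoid_finite R E (Num.max b (Q a)) (Q b).
  by rewrite gt_max Qb.
move: hi1; rewrite gt_max => /andP[bi1 Qai1].
have [V [hV bV V0 [j1 [j2 [k [ij1 j12 ji2 k0 hk]]]]]] := bump_exists i12.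
exists V.
(* The value 1 is included so that V itself is covered. *)
have key lam : 0 < lam <= 1 -> ~ defined_continuous_volume_conserving U
                (fun z => Phi (potential_hamiltonian (fun x => lam * V x)) z dt).
  move=> /andP[lam0 lam1].
  pose W x := lam * V x.
  have W0 q : ~~ (i1 < q < i2) -> W q = 0 by move=> /V0; rewrite /W => ->; rewrite mulr0.
  have hC : Cinf W by apply: (CinfM (f := cst lam)) => //; exact: Cinf_cst.
  apply: (@bump_obstruction R n i0 Phi U dt W a b j1 j2 (lam * k)) => //.
  - move=> q; have /andP[v0 v1] := bV q; rewrite mulr_ge0 ?(ltW lam0) //=.
    by apply: le_trans v1; exact: ler_piMl.
  - by move=> q /andP[_ qb]; apply: W0; rewrite negb_and -leNgt (le_trans qb (ltW bi1)).
  - exact: mulr_gt0.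
  - by move=> q /hk h; rewrite ler_pM2l.
  - exact: ltW.
  - exact: ltW (lt_trans Qai1 ij1).
  - exact: ltW (lt_trans ji2 hi2).
  - apply: hr1; first exact: smooth_potential.
    (* The Hamiltonians agree near every such point, so all prescribed derivatives agree there. *)
    move=> j; apply: near_mpartial; apply: (near_potential W0) => i.
    apply: hE; rewrite mem_cat; apply/orP; left.
    by apply/allpairsP; exists (j, i); split; rewrite ?mem_enum.
  - apply: hr2; first exact: smooth_potential.
    move=> j; apply: near_mpartial; apply: (near_potential W0) => i.
    apply: hE; rewrite mem_cat; apply/orP; right.
    by apply/allpairsP; exists (j, i); split; rewrite ?mem_enum.
split.
- exact: smooth_compact_support_Cinf hV V0.
- have -> : V = (fun x => 1 * V x) by apply/funext => x; rewrite mul1r.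
  by apply: key; rewrite ltr01 lexx.
- by move=> lam /andP[l0 l1]; apply: key; rewrite l0 ltW.
Unshelve. all: by end_near. Qed.
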